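(* Consider the single server G/G/1 queue under last come first serve scheduling with preemptive service (LCFSp), with inter-generation time $X\sim F_X$, $\mathbb{E}[X]=1/\lambda$, and service time $S\sim F_S$, $\mathbb{E}[S]=1/\mu$, $\lambda<\mu$, where at least one of $F_X,F_S$ is continuous. Then the average age is lower bounded by $$A^{\mathrm{ave}}_{\mathrm{G/G/1}}(F_S)\ \ge\ \frac12\frac{\mathbb{E}[X^2]}{\mathbb{E}[X]}.$$ Further, for fixed $F_X$ and $\mu$, this lower bound is achieved asymptotically, i.e. $A^{\mathrm{ave}}_{\mathrm{G/G/1}}(F_S)\to\frac12\frac{\mathbb{E}[X^2]}{\mathbb{E}[X]}$, for: 1. Pareto distributed service, $F_S(s)=1-(\theta(\alpha)/s)^{\alpha}$ for $s\ge\theta(\alpha)$ and $F_S(s)=0$ otherwise, with $\theta(\alpha)=\frac1\mu\left(1-\frac1\alpha\right)$, $\alpha>1$, as $\alpha\to1$; 2. Log-normal distributed service, $S=\exp\{-\log\mu-\frac{\sigma^2}{2}+\sigma N\}$ with $N\sim\mathcal{N}(0,1)$, $\sigma>0$, as $\sigma\to+\infty$; 3. Weibull distributed service, $F_S(s)=1-e^{-(s/\beta)^{\kappa}}$ for $s\ge0$, with $\beta=[\mu\Gamma(1+1/\kappa)]^{-1}$, $\kappa>0$, as $\kappa\to0$.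
   Context: Update packets $i=1,2,\dots$ are generated at times $t_1<t_2<\cdots$ of a renewal process with i.i.d. inter-generation times distributed as $X$. Service times are i.i.d. with distribution $F_S$, independent of the generation process. There is one server, serving one packet at a time; under LCFSp a newly generated packet immediately preempts any packet in service, so packet $i$ (with service time $S_i$) completes service before the next generation, $X_i$ time units later, if and only if $S_i<X_i$; preempted packets are not dropped but when delivered later they carry stale information. If packet $i$ reaches the destination at time $t_i'$ and $\mathcal{P}(t)$ is the set of packets received up to time $t$, the age is $A(t)=\min_{i\in\mathcal{P}(t)}(t-t_i)$ and the average age is $A^{\mathrm{ave}}=\limsup_{T\to\infty}\mathbb{E}\left[\frac1T\int_0^TA(t)\,dt\right]$, denoted $A^{\mathrm{ave}}_{\mathrm{G/G/1}}(F_S)$ for this queue. *)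

(* Defs.v *)
From mathcomp Require Import all_boot all_order all_algebra.
From mathcomp Require Import finmap.
From mathcomp Require Import all_classical all_reals all_analysis.

Set Implicit Arguments.
Unset Strict Implicit.
Unset Printing Implicit Defensive.

Import Order.TTheory GRing.Theory Num.Theory.
Import numFieldNormedType.Exports.

Local Open Scope classical_set_scope.
Local Open Scope ring_scope.

Section probability.
Context {R : realType} {d : measure_display} {T : measurableType d}.
Variable P : probability T R.

(* Only measurable sets are compared: off them a measure is unconstrained, so
   [distribution P Y = F] would be too strong. *)
Definition has_law (Y : {RV P >-> R}) (F : probability R R) : Prop :=
  forall A : set R, measurable A -> P (Y @^-1` A) = F A.

Definition mutually_independent (Y : nat -> {RV P >-> R}) : Prop :=
  forall (J : {fset nat}) (A : nat -> set R), (forall i, measurable (A i)) ->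
    P (\bigcap_(i in [set` J]) (Y i @^-1` A i)) =
    (\prod_(i <- J) P (Y i @^-1` A i))%E.

Definition independent_sequences (Y Z : nat -> {RV P >-> R}) : Prop :=
  forall (J K : {fset nat}) (A B : nat -> set R),
    (forall i, measurable (A i)) -> (forall i, measurable (B i)) ->
    P ((\bigcap_(i in [set` J]) (Y i @^-1` A i)) `&`
       (\bigcap_(k in [set` K]) (Z k @^-1` B k))) =
    (P (\bigcap_(i in [set` J]) (Y i @^-1` A i)) *
     P (\bigcap_(k in [set` K]) (Z k @^-1` B k)))%E.

End probability.

Section laws.
Context {R : realType}.
Implicit Types F : probability R R.

Definition law_cdf F (x : R) : \bar R := F [set` `]-oo, x]].

Definition Gamma (z : R) : R :=
  \int[lebesgue_measure]_(t in `]0, +oo[) (t `^ (z - 1) * expR (- t)).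

Definition pareto_law (mu alpha : R) F : Prop :=
  let theta := mu^-1 * (1 - alpha^-1) in
  forall s, law_cdf F s =
    (if theta <= s then 1 - (theta / s) `^ alpha else 0)%:E.

(* The law of exp (- ln mu - sigma^2 / 2 + sigma * N) for N standard normal. *)
Definition lognormal_law (mu sigma : R) F : Prop :=
  forall A : set R, measurable A ->
    F A = normal_prob 0 1
      ((fun n : R => expR (- ln mu - sigma ^+ 2 / 2 + sigma * n)) @^-1` A).

Definition weibull_law (mu kappa : R) F : Prop :=
  let beta := (mu * Gamma (1 + kappa^-1))^-1 in
  forall s, law_cdf F s =
    (if 0 <= s then 1 - expR (- ((s / beta) `^ kappa)) else 0)%:E.

End laws.

(* Packets are numbered from 0; [X i] is the time between the generations of
   packets [i] and [i.+1], and [S i] is the service time of packet [i]. *)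
Section lcfsp_path.
Context {R : realType}.
Variables X S : nat -> R.

(* The time origin is the generation of the first packet. *)
Definition gen_time (i : nat) : R := \sum_(j < i) X j.

(* Serves, for a duration [x] from time [now] on and with no new generation, a
   stack of pairs (packet, residual service time). Returns the pairs (packet,
   time of service completion) and the stack that remains. *)
Fixpoint serve (x now : R) (q : seq (nat * R)) :
    seq (nat * R) * seq (nat * R) :=
  if q is (i, r) :: q' then
    if r < x then
      let: (out, rest) := serve (x - r) (now + r) q' in
      ((i, now + r) :: out, rest)
    else ([::], (i, r - x) :: q')
  else ([::], [::]).

(* The stack just before packet [n] is generated. A preempted packet stays
   below its preemptor and resumes with its residual service time. *)
Fixpoint backlog (n : nat) : seq (nat * R) :=
  if n is m.+1 then (serve (X m) (gen_time m) ((m, S m) :: backlog m)).2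
  else [::].

Definition completions (n : nat) : seq (nat * R) :=
  (serve (X n) (gen_time n) ((n, S n) :: backlog n)).1.

(* +oo for a packet that never completes service; the set has at most one
   element. *)
Definition reception_time (i : nat) : \bar R :=
  ereal_inf [set u%:E | u in [set u : R | exists n, (i, u) \in completions n]].

Definition received (t : R) : set nat :=
  [set i | (reception_time i <= t%:E)%E].

(* Before the first reception, when [received t] is empty, the age is [a0 + t]:
   the destination has age [a0] at time 0. The value [a0 + t] does not affect
   the infimum at later times, since generation times and [a0] are
   nonnegative. *)
Definition age (a0 t : R) : R :=
  inf ([set a0 + t] `|` [set t - gen_time i | i in received t]).

End lcfsp_path.

Record gg1_queue (R : realType) (FX FS : probability R R) := GG1Queue {
  gg1_disp : measure_display;
  gg1_space : measurableType gg1_disp;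
  gg1_prob : probability gg1_space R;
  gg1_X : nat -> {RV gg1_prob >-> R};
  gg1_S : nat -> {RV gg1_prob >-> R};
  gg1_X_gt0 : forall i w, 0 < gg1_X i w;
  gg1_S_ge0 : forall i w, 0 <= gg1_S i w;
  gg1_X_law : forall i, has_law (gg1_X i) FX;
  gg1_S_law : forall i, has_law (gg1_S i) FS;
  gg1_X_indep : mutually_independent gg1_X;
  gg1_S_indep : mutually_independent gg1_S;
  gg1_XS_indep : independent_sequences gg1_X gg1_S }.

Section average_age.
Context {R : realType} {FX FS : probability R R}.

Definition queue_age (a0 : R) (Q : gg1_queue FX FS) (t : R) (w : gg1_space Q) :
    R :=
  age (fun i => gg1_X Q i w) (fun i => gg1_S Q i w) a0 t.

Definition average_age (a0 : R) (Q : gg1_queue FX FS) : \bar R :=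
  limf_esup (fun T : R =>
    ('E_(gg1_prob Q)[fun w =>
      (T^-1 * \int[lebesgue_measure]_(t in `[0, T]) queue_age a0 t w)%R])%E)
    +oo.

End average_age.

Definition law_mean (R : realType) (F : probability R R) : \bar R :=
  ('E_F[fun x : R => x])%E.

Definition law_moment2 (R : realType) (F : probability R R) : \bar R :=
  ('E_F[fun x : R => (x ^+ 2)%R])%E.

Definition age_bound (R : realType) (FX : probability R R) : \bar R :=
  ((2^-1)%:E * (law_moment2 FX / law_mean FX))%E.

(* Main.v *)
Require Import Defs.
From HB Require Import structures.
From mathcomp Require Import all_boot all_order all_algebra finmap.
From mathcomp Require Import all_classical all_reals all_analysis.
From mathcomp Require Import measurable_realfun.
From mathcomp Require Import ring lra.
Import Order.TTheory GRing.Theory Num.Theory.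
Import numFieldNormedType.Exports.
Set Implicit Arguments.
Unset Strict Implicit.
Unset Printing Implicit Defensive.
Local Open Scope classical_set_scope.
Local Open Scope ring_scope.

(** Between the generations of packets [i] and [i + 1], at times
    [t_i < t_{i+1}], the age at time [t] is at least [t - t_i], and it exceeds
    this value only while packet [i] is in service, by at most the age [D_i] of
    the destination at time [t_i]. Hence the integral of the age over [[0, T]]
    lies, up to boundary terms, between the sum of [X_i^2 / 2] and the sum of
    [X_i^2 / 2 + D_i * min (S_i, X_i)], both over the [i] with [t_i <= T].
    Each summand is the product of functions of packet [i] and of a function of
    the earlier packets, so expectations factor as in Wald's identity; applied
    to [X_i] and to [min (X_i, M)], the identity shows that the expected number
    of generations up to [T] is equivalent to [lambda * T]. This gives the lower
    bound for every service law. If [P (S > delta)] tends to 0 for every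
    [delta > 0], then [E[min (S, X)]] tends to 0 while [D_i] stays bounded on
    average, so the two bounds meet; the three families satisfy this although
    their mean is fixed. *)

(** * Expectations and independence *)

(* Unlike [ge0_le_integral], no measurability: the integral of a nonnegative
   function is a supremum over the simple functions below it. *)
Lemma ge0_le_integral_nomeas d (T : measurableType d) (R : realType)
    (mu : {measure set T -> \bar R}) (D : set T) (f g : T -> \bar R) :
  (forall x, D x -> (0 <= f x)%E) -> (forall x, D x -> (f x <= g x)%E) ->
  (\int[mu]_(x in D) f x <= \int[mu]_(x in D) g x)%E.
Proof.
move=> f0 fg; have g0 x : D x -> (0 <= g x)%E.
  by move=> Dx; exact: le_trans (f0 _ Dx) (fg _ Dx).
rewrite !ge0_integralE//; apply: ereal_sup_le => _ [h /= hf <-].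
exists h => //= x; apply: le_trans (hf x) _.
by rewrite /patch; case: ifPn => // /set_mem; exact: fg.
Qed.

Section ge0_expectation.
Local Open Scope ereal_scope.
Context d (T : measurableType d) (R : realType) (P : probability T R).
Implicit Types f g : T -> R.

Lemma ge0_le_expectation f g : (forall w, 0 <= f w)%R ->
  (forall w, f w <= g w)%R -> 'E_P[f] <= 'E_P[g].
Proof.
move=> f0 fg; rewrite unlock; apply: ge0_le_integral_nomeas => x _.
  by rewrite lee_fin.
by rewrite lee_fin.
Qed.

Lemma ge0_expectationD f g : measurable_fun setT f -> measurable_fun setT g ->
  (forall w, 0 <= f w)%R -> (forall w, 0 <= g w)%R ->
  'E_P[(fun w => f w + g w)%R] = 'E_P[f] + 'E_P[g].
Proof.
move=> mf mg f0 g0; rewrite unlock -ge0_integralD//.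
- by move=> x _; rewrite lee_fin.
- exact/measurable_EFinP.
- by move=> x _; rewrite lee_fin.
- exact/measurable_EFinP.
Qed.

Lemma ge0_expectationZl f (k : R) : measurable_fun setT f ->
  (forall w, 0 <= f w)%R -> (0 <= k)%R ->
  'E_P[(fun w => k * f w)%R] = k%:E * 'E_P[f].
Proof.
move=> mf f0 k0; rewrite unlock -ge0_integralZl_EFin//.
- by move=> x _; rewrite lee_fin.
- exact/measurable_EFinP.
Qed.

Lemma ge0_expectation_sum n (f : nat -> T -> R) :
  (forall i, (i < n)%N -> measurable_fun setT (f i)) ->
  (forall i w, 0 <= f i w)%R ->
  'E_P[(fun w => \sum_(i < n) f i w)%R] = \sum_(i < n) 'E_P[f i].
Proof.
move=> + f0; elim: n => [_|n IH mf].
  rewrite big_ord0 (_ : (fun w => _) = cst 0%R) ?expectation_cst//.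
  by apply/funext => w; rewrite big_ord0.
rewrite big_ord_recr/= -IH => [|i ni]; last exact/mf/ltnW.
rewrite -ge0_expectationD//.
- by congr expectation; apply/funext => w; rewrite big_ord_recr.
- by apply: measurable_sum => i; apply: mf; rewrite ltnS ltnW.
- exact: mf.
- by move=> w; exact: sumr_ge0.
Qed.

(** By uniqueness of the product measure, the law of the pair is the product of the laws of [f] and
    [g], and Tonelli splits the integral. Absolute values keep the integrand nonnegative on the
    whole plane. *)
Lemma expectation_mul_indep f g :
  measurable_fun setT f -> measurable_fun setT g ->
  (forall w, 0 <= f w)%R -> (forall w, 0 <= g w)%R ->
  (forall A B : set R, measurable A -> measurable B ->
    P (f @^-1` A `&` g @^-1` B) = P (f @^-1` A) * P (g @^-1` B)) ->
  'E_P[(fun w => f w * g w)%R] = 'E_P[f] * 'E_P[g].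
Proof.
move=> mf mg f0 g0 fg.
pose F : {mfun T >-> R} := HB.pack f (isMeasurableFun.Build _ _ _ _ f mf).
pose G : {mfun T >-> R} := HB.pack g (isMeasurableFun.Build _ _ _ _ g mg).
pose mF := distribution P F; pose mG := distribution P G.
have mfg : measurable_fun setT (fun w => (f w, g w)).
  exact: measurable_fun_pair.
pose FG : {mfun T >-> (R * R)%type} :=
  HB.pack (fun w => (f w, g w)) (isMeasurableFun.Build _ _ _ _ _ mfg).
pose h (z : R * R) : \bar R := (`|z.1| * `|z.2|)%R%:E.
have mh : measurable_fun setT h.
  apply/measurable_EFinP; apply: measurable_funM.
    exact: measurableT_comp.
  exact: measurableT_comp.
have h0 z : 0 <= h z by rewrite lee_fin mulr_ge0.
have mn : measurable_fun setT (fun x : R => `|x|%R%:E).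
  exact/measurable_EFinP.
transitivity (\int[distribution P FG]_z h z).
  rewrite /distribution ge0_integral_pushforward//.
  rewrite unlock preimage_setT; apply: eq_integral => w _ /=.
  by rewrite /h/= !ger0_norm.
rewrite (eq_measure_integral (mF \x mG)%E); last first.
  move=> A mA _; apply/esym; apply: product_measure_unique; last exact: mA.
  by move=> B C mB mC; rewrite -[RHS]fg.
rewrite fubini_tonelli1// /fubini_F/=.

have inner x : \int[mG]_y h (x, y) = `|x|%:E * 'E_P[g].
  rewrite /h/=; under eq_integral do rewrite EFinM.
  rewrite ge0_integralZl_EFin//.
  rewrite /mG /distribution ge0_integral_pushforward// preimage_setT unlock.
  by congr (_ * _); apply: eq_integral => w _ /=; rewrite ger0_norm.
under eq_integral do rewrite inner.
rewrite ge0_integralZr//; last exact: expectation_ge0.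
congr (_ * _).
rewrite /mF /distribution ge0_integral_pushforward// unlock preimage_setT.
by apply: eq_integral => w _ /=; rewrite ger0_norm.
Qed.

(** Restricting [P] to [B] and scaling it by [P B] give two finite measures, [m1] and [m2]; agreeing
    on a pi-system and on the whole space, they agree on the generated sigma-algebra. *)
Lemma indep_sigma_algebra (G : set (set T)) (B : set T) : setI_closed G ->
  G `<=` measurable -> measurable B ->
  (forall A, G A -> P (A `&` B) = P A * P B) ->
  forall A, <<s G >> A -> P (A `&` B) = P A * P B.
Proof.
move=> IG mG mB GB A sA.
have PB : (fine (P B))%:E = P B by rewrite fineK ?fin_num_measure.
have PB0 : (0 <= fine (P B))%R by rewrite fine_ge0.
pose m1 := mrestr P mB.
pose m2 := mscale (NngNum PB0) P.
have E (X : set T) : m2 X = P X * P B.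
  by rewrite /m2/= /mscale/= PB muleC.
rewrite -E -[LHS]/(m1 A).
apply: (@g_sigma_algebra_measure_unique_trace _ R T G setT measurableT) => //.
- by move=> X [/mG].
- by move=> X Y [GX _] [GY _]; split => //; exact: IG.
- apply: etrans (esym (E _)).
  by rewrite /m1/= /mrestr setTI probability_setT mul1e.
- by move=> X [GX _]; apply: etrans (esym (E _)); exact: GB.
- by rewrite /m1/= /mrestr setTI ltey_eq fin_num_measure.
- move: sA; congr (_ A); congr smallest; apply/funext => X.
  by apply/propext; split => [|[]].
Qed.

End ge0_expectation.

(** Built by recursion so that each step adds one fresh index and finite products split off their
    last factor. *)
Fixpoint initial_fset (n : nat) : {fset nat} :=
  if n is m.+1 then (m |` initial_fset m)%fset else fset0.

Lemma in_initial_fset n k : (k \in initial_fset n) = (k < n)%N.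
Proof.
elim: n => [|n IH]/=; first by rewrite inE.
by rewrite in_fset1U IH ltnS [RHS]leq_eqVlt.
Qed.

(** * Events of the past and their independence from the next variable *)

Section past.
Local Open Scope ereal_scope.
Context d (T : measurableType d) (R : realType) (P : probability T R).
Implicit Types (Y Z : nat -> {RV P >-> R}) (A B : nat -> set R).

Definition cylinder Y A n : set T :=
  \bigcap_(i in [set` initial_fset n]) (Y i @^-1` A i).

(* A pi-system generating the sigma-algebra of [Y 0, ..., Y m.-1] and
   [Z 0, ..., Z n.-1]. *)
Definition past Y Z m n : set (set T) :=
  [set C | exists A B, [/\ forall i, measurable (A i),
    forall i, measurable (B i) & C = cylinder Y A m `&` cylinder Z B n]].

Lemma pastC Y Z m n : past Y Z m n = past Z Y n m.
Proof.
by apply/seteqP; split => C [A [B [mA mB ->]]]; exists B, A; rewrite setIC.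
Qed.

Lemma measurable_cylinder Y A n : (forall i, measurable (A i)) ->
  measurable (cylinder Y A n).
Proof.
move=> mA; apply: bigcap_measurableType => i _.
exact: measurable_funPTI.
Qed.

Lemma past_measurable Y Z m n : past Y Z m n `<=` measurable.
Proof.
by move=> C [A [B [mA mB ->]]]; apply: measurableI; exact: measurable_cylinder.
Qed.

Lemma past_setI_closed Y Z m n : setI_closed (past Y Z m n).
Proof.
move=> _ _ [A [B [mA mB ->]]] [A' [B' [mA' mB' ->]]].
exists (fun i => A i `&` A' i), (fun i => B i `&` B' i).
split; try by move=> i; exact: measurableI.
by rewrite setIACA /cylinder -!bigcapI.
Qed.

Lemma cylinder_indepS Y A n : mutually_independent Y ->
  (forall i, measurable (A i)) ->
  P (cylinder Y A n.+1) = P (Y n @^-1` A n) * P (cylinder Y A n).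
Proof.
move=> iY mA; rewrite /cylinder !iY//= big_fsetU1//=.
by rewrite in_initial_fset ltnn.
Qed.

Lemma independent_sequencesC Y Z :
  independent_sequences Y Z -> independent_sequences Z Y.
Proof. by move=> YZ J K A B mA mB; rewrite setIC YZ// muleC. Qed.

(** The event on [Y m] becomes one more constraint of the cylinder of [Y], at the index [m] that [C]
    leaves free, and independence splits off its factor. *)
Lemma past_indep Y Z m n (A : set R) (C : set T) : mutually_independent Y ->
  independent_sequences Y Z -> measurable A -> past Y Z m n C ->
  P (C `&` Y m @^-1` A) = P C * P (Y m @^-1` A).
Proof.
move=> iY YZ mA [A' [B [mA' mB ->]]].
pose A'' i := if i == m then A else A' i.
have mA'' i : measurable (A'' i) by rewrite /A''; case: ifP.
have A''m : A'' m = A by rewrite /A'' eqxx.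
have cA : cylinder Y A'' m = cylinder Y A' m.
  apply: eq_bigcapr => i /=; rewrite in_initial_fset => im.
  by rewrite /A'' ltn_eqF.
have -> : cylinder Y A' m `&` cylinder Z B n `&` Y m @^-1` A =
    cylinder Y A'' m.+1 `&` cylinder Z B n.
  rewrite setIAC; congr (_ `&` _).
  rewrite setIC -cA /cylinder/= set_fsetU set_fset1 bigcap_setU bigcap_set1.
  by rewrite A''m.
rewrite {1}/cylinder YZ// [in RHS]YZ// -!/(cylinder _ _ _).
by rewrite cylinder_indepS// A''m cA [X in X * _]muleC muleAC.
Qed.

Lemma measurable_fun_past Y Z m n j : (j < m)%N ->
  measurable_fun (setT : set (g_sigma_algebraType (past Y Z m n))) (Y j).
Proof.
move=> jm _ A mA; rewrite setTI; apply: sub_sigma_algebra.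
exists (fun i => if i == j then A else setT), (fun=> setT); split => //.
  by move=> i; case: ifP.
rewrite [X in _ `&` X](_ : _ = setT) ?setIT; last first.
  by apply/seteqP; split => // w _ i _.
apply/seteqP; split => [w Aw i _/=|w /(_ j)/=].
  by case: eqP => // ->.
by rewrite eqxx; apply; rewrite in_initial_fset.
Qed.

Lemma past_measurable_fun Y Z m n (h : T -> R) :
  measurable_fun (setT : set (g_sigma_algebraType (past Y Z m n))) h ->
  measurable_fun setT h.
Proof.
move=> mh _ A mA; have := mh measurableT A mA.
rewrite /measurable/=; apply: smallest_sub; last exact: past_measurable.
exact: sigma_algebra_measurable.
Qed.

(** The factorization behind Wald's identity: [h] is a function of the past, which is independent of
    [Y m]. *)
Lemma past_expectation_mul Y Z m n (h : T -> R) (f : R -> R) :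
  mutually_independent Y -> independent_sequences Y Z ->
  measurable_fun (setT : set (g_sigma_algebraType (past Y Z m n))) h ->
  measurable_fun setT f -> (forall w, 0 <= h w)%R -> (forall x, 0 <= f x)%R ->
  'E_P[(fun w => h w * f (Y m w))%R] = 'E_P[h] * 'E_P[f \o Y m].
Proof.
move=> iY YZ mh mf h0 f0.
have mYT (A : set R) : measurable A -> measurable (Y m @^-1` A).
  by move=> mA; exact: measurable_funPTI.
apply: expectation_mul_indep => //.
- exact: past_measurable_fun mh.
- by apply: measurableT_comp => //; exact: measurable_funPT.
move=> A B mA mB; rewrite comp_preimage.
have mfB : measurable (f @^-1` B) by rewrite -[_ @^-1` _]setTI; exact: mf.
apply: (indep_sigma_algebra (@past_setI_closed Y Z m n)).
- exact: past_measurable.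
- exact: (mYT _ mfB).
- by move=> C; exact: (past_indep iY YZ mfB).
- by have := mh measurableT A mA; rewrite setTI.
Qed.

End past.

(** * Sample paths of the queue *)

Section sample_path.
Context {R : realType}.
Variables (X S : nat -> R) (a0 : R).
Hypotheses (X_gt0 : forall i, 0 < X i) (S_ge0 : forall i, 0 <= S i).
Hypothesis a0_ge0 : 0 <= a0.

Local Notation t_ := (gen_time X).

Lemma gen_timeS n : t_ n.+1 = t_ n + X n.
Proof. by rewrite /gen_time big_ord_recr. Qed.

Lemma gen_time0 : t_ 0 = 0.
Proof. by rewrite /gen_time big_ord0. Qed.

Lemma gen_time_le m n : (m <= n)%N -> t_ m <= t_ n.
Proof.
elim: n => [|n IH]; first by rewrite leqn0 => /eqP ->.
rewrite leq_eqVlt ltnS => /orP[/eqP -> //|/IH/le_trans]; apply.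
by rewrite gen_timeS lerDl ltW.
Qed.

Lemma gen_time_ge0 n : 0 <= t_ n.
Proof. by rewrite -gen_time0 gen_time_le. Qed.

Lemma gen_time_lt_inv m n : t_ m < t_ n -> (m < n)%N.
Proof. by apply: contraTT; rewrite -leqNgt -leNgt; exact: gen_time_le. Qed.

(** Taking for [K] the packets generated so far shows that no packet completes before its
    generation. *)
Lemma serve_inv (K : pred nat) x now q :
  all (fun p : nat * R => K p.1 && (0 <= p.2)) q ->
  all (fun p => K p.1 && (now <= p.2)) (serve x now q).1 &&
  all (fun p => K p.1 && (0 <= p.2)) (serve x now q).2.
Proof.
elim: q x now => [//|[i r] q IH] x now /= /andP[/andP[Ki r0] Kq].
case: ltP => rx /=; last by rewrite Ki subr_ge0 rx Kq.
have := IH (x - r) (now + r) Kq.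
case: (serve _ _ _) => out rest /= /andP[Kout ->].
rewrite Ki lerDl r0 !andbT/=.
apply: sub_all Kout => p /andP[-> /(le_trans _)]; apply.
by rewrite lerDl.
Qed.

Lemma backlog_inv n :
  all (fun p : nat * R => (p.1 < n)%N && (0 <= p.2)) (backlog X S n).
Proof.
elim: n => [//|n IH].
suff H : all (fun p : nat * R => (p.1 < n.+1)%N && (0 <= p.2))
    ((n, S n) :: backlog X S n).
  by have /andP[_] := serve_inv (K := fun i => (i < n.+1)%N) (X n) (t_ n) H.
rewrite /= ltnS leqnn S_ge0/=; apply: sub_all IH => p /andP[pn ->].
by rewrite ltnS ltnW.
Qed.

Lemma completions_inv n k u : (k, u) \in completions X S n ->
  (k <= n)%N /\ t_ n <= u.
Proof.
have H : all (fun p : nat * R => (p.1 < n.+1)%N && (0 <= p.2))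
    ((n, S n) :: backlog X S n).
  rewrite /= ltnS leqnn S_ge0/=; apply: sub_all (backlog_inv n) => p.
  by move=> /andP[pn ->]; rewrite ltnS ltnW.
have /andP[/allP C _] :=
  serve_inv (K := fun i => (i < n.+1)%N) (X n) (t_ n) H.
by move=> /C /= /andP[]; rewrite ltnS.
Qed.

Lemma received_gen_time_le t k : received X S t k -> t_ k <= t.
Proof.
rewrite /received/= => /(le_trans _) H; rewrite -lee_fin; apply: H.
apply: le_ereal_inf_tmp => _ [u [n /completions_inv[kn nu]] <-].
by rewrite lee_fin (le_trans _ nu)// gen_time_le.
Qed.

(** Packet [k] is on top of the stack at its own generation, so it is the first to complete. *)
Lemma received_good k t : S k < X k -> t_ k + S k <= t -> received X S t k.
Proof.
move=> SX kt; rewrite /received/=.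
apply: (@le_trans _ _ (t_ k + S k)%:E); last by rewrite lee_fin.
apply: ereal_inf_lbound; exists (t_ k + S k) => //; exists k.
rewrite /completions/= SX; case: (serve _ _ _) => out rest /=.
by rewrite inE eqxx.
Qed.

Lemma le_age c t : c <= a0 + t ->
  (forall k, received X S t k -> c <= t - t_ k) -> c <= age X S a0 t.
Proof.
move=> c0 ck; apply: lb_le_inf; first by exists (a0 + t); left.
by move=> _ [->//|[k /ck ckt <-]].
Qed.

Lemma age_ge0 t : 0 <= t -> 0 <= age X S a0 t.
Proof.
move=> t0; apply: le_age => [|k /received_gen_time_le]; first exact: addr_ge0.
by rewrite subr_ge0.
Qed.

(** Before [t_ i.+1] no packet later than [i] has been generated, let alone received; the initial
    value [a0 + t] is at least [t - t_ i] because [a0] and [t_ i] are nonnegative. *)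
Lemma age_ge_recurrence i t : 0 <= t -> t < t_ i.+1 ->
  t - t_ i <= age X S a0 t.
Proof.
move=> t0 ti; apply: le_age => [|k /received_gen_time_le kt].
  by have := gen_time_ge0 i; have := a0_ge0; lra.
rewrite lerD2l lerN2 gen_time_le// -ltnS gen_time_lt_inv//.
exact: le_lt_trans ti.
Qed.

Lemma has_lbound_ages t : 0 <= t ->
  has_lbound ([set a0 + t] `|` [set t - t_ i | i in received X S t]).
Proof.
move=> t0; exists 0 => _ [->|[k /received_gen_time_le kt <-]].
  exact: addr_ge0.
by rewrite subr_ge0.
Qed.

Lemma age_le_initial t : 0 <= t -> age X S a0 t <= a0 + t.
Proof. by move=> t0; apply: ge_inf; [exact: has_lbound_ages|left]. Qed.

Lemma age_le_good k t : S k < X k -> t_ k + S k <= t ->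
  age X S a0 t <= t - t_ k.
Proof.
move=> SX kt; have t0 : 0 <= t.
  by apply: le_trans kt; rewrite addr_ge0// gen_time_ge0.
apply: ge_inf; first exact: has_lbound_ages.
by right; exists k => //; exact: received_good.
Qed.

(* An upper bound for the age at the generation of packet [n]: the time elapsed
   since the generation of the last packet before [n] that was not
   preempted. *)
Fixpoint stale_age (n : nat) : R :=
  if n is m.+1 then X m + (if S m < X m then 0 else stale_age m) else a0.

Lemma stale_age_ge0 n : 0 <= stale_age n.
Proof.
elim: n => [//|n IH] /=; rewrite addr_ge0 ?(ltW (X_gt0 _))//.
by case: ifP.
Qed.

(** If packet [n] is served in its interval, it bounds the age by [t - t_ n]; otherwise [t_] and
    [stale_age] both grow by [X n] and the bound does not change. *)
Lemma age_le_stale n t : t_ n <= t -> age X S a0 t <= t - t_ n + stale_age n.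
Proof.
elim: n => [|n IH] nt.
  rewrite gen_time0 in nt.
  by rewrite gen_time0 subr0 /= addrC; exact: age_le_initial.
rewrite gen_timeS /= in nt *; have Xn := X_gt0 n.
case: ltP => SX.
  have := @age_le_good n t SX; lra.
by have := IH (ltac:(lra)); lra.
Qed.

(** Once packet [n] is served, the age is at most [t - t_ n]; if [X n <= S n], the support of the
    indicator is the whole interval and the stale bound applies throughout. *)
Lemma age_le_interval n t : t_ n <= t < t_ n.+1 ->
  age X S a0 t <= t - t_ n +
    stale_age n * \1_(`[t_ n, (t_ n + Num.min (S n) (X n))[) t.
Proof.
move=> /andP[nt tn]; rewrite indicE.
case: (boolP (t \in _)) => tnS.
  by rewrite mulr1; exact: age_le_stale.
rewrite mulr0 addr0; move: tnS; rewrite notin_setE /= in_itv/= nt/=.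
move=> /negP; rewrite -leNgt minElt; case: ltP => SX.
  exact: age_le_good.
by move: tn; rewrite gen_timeS; lra.
Qed.

End sample_path.

(** The triangle under the curve [t - t_i] between two generations, source of the terms
    [X_i ^+ 2 / 2]. *)
Lemma integral_ramp (R : realType) (a b : R) : a <= b ->
  (\int[lebesgue_measure]_x ((x - a) * \1_(`[a, b[) x)%:E =
   ((b - a) ^+ 2 / 2)%:E)%E.
Proof.
move=> ab.
transitivity (\int[lebesgue_measure]_(x in `[a, b[) (x - a)%:E)%E.
  rewrite [RHS]integral_mkcond; apply: eq_integral => x _.
  by rewrite patchE indicE; case: ifP => _; rewrite (mulr1, mulr0).
have mf : measurable_fun setT (fun x : R => (x - a)%:E).
  by apply/measurable_EFinP; exact: measurable_funB.
rewrite integral_itv_bndo_bndc; last exact: measurable_funTS.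
move: ab; rewrite le_eqVlt => /predU1P[->|ab].
  by rewrite subrr expr0n/= mul0r set_itv1 integral_set1.
have dF (x : R) : is_derive x 1 (fun x : R => (x - a) ^+ 2 / 2) (x - a).
  apply: is_derive_eq.
  by rewrite !scaler0 add0r subr0 /GRing.scale/= mulr1; field.
have cF : continuous (fun x : R => (x - a) ^+ 2 / 2).
  move=> x; apply: differentiable_continuous; apply/derivable1_diffP.
  exact: ex_derive.
rewrite (@continuous_FTC2 _ _ (fun x => (x - a) ^+ 2 / 2))//.
- by rewrite subrr expr0n/= mul0r sube0.
- apply: continuous_subspaceT => x; apply: cvgB; [exact: cvg_id|exact: cvg_cst].
- split.
  + by move=> x _; exact: ex_derive.
  + by apply: cvg_at_right_filter; exact: cF.
  + by apply: cvg_at_left_filter; exact: cF.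
- by move=> x _; rewrite derive1E derive_val.
Qed.

(** * Pathwise bounds for the integral of the age *)

Section age_integral.
Context {R : realType}.
Variables (X S : nat -> R) (a0 T : R).
Hypotheses (X_gt0 : forall i, 0 < X i) (S_ge0 : forall i, 0 <= S i).
Hypotheses (a0_ge0 : 0 <= a0) (T_ge0 : 0 <= T).

Local Notation t_ := (gen_time X).
Local Notation mu := (@lebesgue_measure R).
Local Notation A := (age X S a0).
Local Notation D_ := (stale_age X S a0).

Let ramp i (t : R) := (t - t_ i) * \1_(`[t_ i, t_ i.+1[) t.

Let ramp_ge0 i t : 0 <= ramp i t.
Proof.
rewrite /ramp indicE; case: (boolP (t \in _)); rewrite ?mulr0// mulr1.
by rewrite inE/= in_itv/= => /andP[it _]; rewrite subr_ge0.
Qed.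

Let m_indic (a b : R) : measurable_fun setT (\1_(`[a, b[) : R -> R).
Proof. exact: measurable_indic. Qed.

Let m_scale (c : R) (f : R -> R) : measurable_fun setT f ->
  measurable_fun setT (fun t => c * f t).
Proof. by move=> mf; exact: measurable_funM. Qed.

Let m_ramp i : measurable_fun setT (ramp i).
Proof. by apply: measurable_funM => //; exact: measurable_funB. Qed.

Let int_ramp i : (\int[mu]_t (ramp i t)%:E = (X i ^+ 2 / 2)%:E)%E.
Proof.
rewrite integral_ramp ?gen_time_le//; congr ((_ ^+ 2 / 2)%:E).
by rewrite gen_timeS addrAC subrr add0r.
Qed.

Let int_indic (a b : R) : a <= b ->
  (\int[mu]_t (\1_(`[a, b[) t)%:E = (b - a)%:E)%E.
Proof.
move=> ab; rewrite integral_indic// setIT.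
apply: etrans (lebesgue_measure_itv _) _ => /=.
rewrite lte_fin.
by case: ltgtP ab => // -> _; rewrite subrr.
Qed.

(** The real-valued integral is the finite part of the extended one; nothing is lost, because the
    age is at most [a0 + T] on the horizon. *)
Lemma EFin_integral_age : ((\int[mu]_(t in `[0, T]) A t)%:E =
  \int[mu]_t ((EFin \o A) \_ `[0%R, T]) t)%E.
Proof.
rewrite -integral_mkcond /Rintegral fineK// fin_numElt.
have A0 t : [set` `[0, T]] t -> (0 <= (A t)%:E)%E.
  by rewrite /= in_itv/= lee_fin => /andP[? _]; exact: age_ge0.
rewrite (lt_le_trans (ltNyr 0))/=; last exact: integral_ge0.
apply: (@le_lt_trans _ _ (\int[mu]_(t in `[0%R, T]) (a0 + T)%:E)%E).
  apply: ge0_le_integral_nomeas => // t; rewrite /= in_itv/= => /andP[t0 tT].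
  rewrite lee_fin; apply: le_trans (age_le_initial X_gt0 S_ge0 a0_ge0 t0) _.
  by rewrite lerD2l.
rewrite integral_cst//=; set m := (X in (_ * X)%E).
have -> : m = (if 0 < T then T - 0 else 0)%:E.
  apply: etrans (lebesgue_measure_itv _) _ => /=; rewrite lte_fin.
  by case: ifP.
by rewrite -EFinM ltry.
Qed.

Let ramp_out i t : ~~ (t_ i <= t < t_ i.+1) -> ramp i t = 0.
Proof.
move=> it; rewrite /ramp indicE; case: (boolP (t \in _)); rewrite ?mulr0//.
by rewrite inE/= in_itv/= (negbTE it).
Qed.

Let ramp_in i t : t_ i <= t < t_ i.+1 -> ramp i t = t - t_ i.
Proof. by move=> it; rewrite /ramp indicE mem_set ?mulr1//= in_itv. Qed.

(** The ramps have disjoint supports, so at most one term is nonzero at [t]; the weights keep only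
    the intervals that end by [T]. *)
Let sum_ramp_le_age n (t : R) :
  \sum_(i < n) (t_ i.+1 <= T)%R%:R * ramp i t <=
  if (0 <= t <= T) && (t < t_ n) then A t else 0.
Proof.
elim: n => [|n IH].
  by rewrite big_ord0; case: ifP => // /andP[/andP[t0 _] _]; exact: age_ge0.
rewrite big_ord_recr/=; have nn1 := gen_time_le X_gt0 (leqnSn n).
case: (ltP t (t_ n)) IH => tn IH.
  rewrite ramp_out ?mulr0 ?addr0; last by rewrite leNgt tn.
  by rewrite (lt_le_trans tn nn1).
rewrite andbF in IH; apply: le_trans (lerD IH (lexx _)) _; rewrite add0r.
case: (ltP t (t_ n.+1)) => tn1; last first.
  by rewrite ramp_out ?mulr0 ?andbF// tn ltNge tn1.
have t0 : 0 <= t by apply: le_trans tn; exact: gen_time_ge0.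
rewrite t0 andbT; case: (leP (t_ n.+1) T) => nT.
  rewrite (ltW (lt_le_trans tn1 nT))/= mul1r ramp_in ?tn//.
  exact: age_ge_recurrence.
by rewrite mul0r; case: ifP => _ //; exact: age_ge0.
Qed.

Lemma ge_integral_age n :
  \sum_(i < n) (t_ i.+1 <= T)%R%:R * (X i ^+ 2 / 2) <=
  \int[mu]_(t in `[0, T]) A t.
Proof.
rewrite -lee_fin EFin_integral_age -sumEFin.
have -> : (\sum_(i < n) ((t_ i.+1 <= T)%R%:R * (X i ^+ 2 / 2))%:E =
    \int[mu]_t \sum_(i < n) ((t_ i.+1 <= T)%R%:R * ramp i t)%:E)%E.
  rewrite ge0_integral_sum//.
  - apply: eq_bigr => i _; rewrite EFinM -int_ramp -ge0_integralZl_EFin//.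
    + by move=> t _; rewrite lee_fin.
    + by apply/measurable_EFinP; exact: m_ramp.
  - by move=> i; apply/measurable_EFinP; apply: m_scale; exact: m_ramp.
  - by move=> i t _; rewrite lee_fin mulr_ge0.
apply: ge0_le_integral_nomeas => t _; rewrite sumEFin.
  by rewrite lee_fin; apply: sumr_ge0 => i _; rewrite mulr_ge0.
have := sum_ramp_le_age n t; rewrite patchE -lee_fin => /le_trans; apply.
case: (boolP (0 <= t <= T)) => /= tT.
  rewrite mem_set/= ?in_itv//= lee_fin; case: ifP => // _.
  by apply: age_ge0 => //; case/andP: tT.
by case: ifP => //; rewrite inE/= in_itv/= (negbTE tT).
Qed.

(** Majorizes the age on the interval of packet [i] and vanishes elsewhere. *)
Let excess i (t : R) := ramp i t +
  D_ i * \1_(`[t_ i, t_ i + Num.min (S i) (X i)[) t.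

Let excess_ge0 i t : 0 <= excess i t.
Proof. by rewrite addr_ge0// mulr_ge0 ?stale_age_ge0. Qed.

Let age_le_sum n (t : R) : 0 <= t <= T -> t < t_ n ->
  A t <= \sum_(i < n) (t_ i <= T)%R%:R * excess i t.
Proof.
move=> /andP[t0 tT]; elim: n => [|n IH] tn.
  by rewrite ltNge gen_time0 t0 in tn.
rewrite big_ord_recr/=; case: (ltP t (t_ n)) => [/IH/le_trans|nt].
  by apply; rewrite lerDl mulr_ge0.
apply: ler_wpDl; first by apply: sumr_ge0 => i _; rewrite mulr_ge0.
rewrite (le_trans nt tT) mul1r /excess ramp_in ?nt//.
by apply: (age_le_interval X_gt0) => //; rewrite nt.
Qed.

(** Intervals begun by [T] are counted in full. If [t_ n <= T], the first [n] intervals miss the end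
    of the horizon, where the age is bounded crudely by [a0 + T]. *)
Lemma integral_age_le n :
  \int[mu]_(t in `[0, T]) A t <=
  \sum_(i < n) (t_ i <= T)%R%:R *
    (X i ^+ 2 / 2 + D_ i * Num.min (S i) (X i)) +
  (t_ n <= T)%R%:R * ((a0 + T) * T).
Proof.
have mSX i : 0 <= Num.min (S i) (X i) by rewrite le_min S_ge0 ltW.
have D0 i : 0 <= D_ i by exact: stale_age_ge0.
have m_excess i : measurable_fun setT (excess i).
  by apply: measurable_funD; [exact: m_ramp|apply: m_scale; exact: m_indic].
have int_excess i : (\int[mu]_t (excess i t)%:E =
    (X i ^+ 2 / 2 + D_ i * Num.min (S i) (X i))%:E)%E.
  under eq_integral do rewrite EFinD.
  rewrite ge0_integralD//; last first.
  - by apply/measurable_EFinP; apply: m_scale; exact: m_indic.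
  - by move=> t _; rewrite lee_fin mulr_ge0.
  - by apply/measurable_EFinP; exact: m_ramp.
  - by move=> t _; rewrite lee_fin.
  rewrite int_ramp EFinD; congr (_ + _)%E.
  under eq_integral do rewrite EFinM.
  rewrite ge0_integralZl_EFin//; last by apply/measurable_EFinP; exact: m_indic.
  rewrite int_indic ?lerDl// EFinM; congr (_ * _%:E)%E.
  by rewrite addrAC subrr add0r.
pose last t : R := (t_ n <= T)%R%:R * (a0 + T) * \1_(`[0, T]) t.
have last_ge0 t : 0 <= last t by rewrite !mulr_ge0// addr_ge0.
rewrite -lee_fin EFin_integral_age EFinD -sumEFin.
have -> : (\sum_(i < n) ((t_ i <= T)%R%:R *
    (X i ^+ 2 / 2 + D_ i * Num.min (S i) (X i)))%:E =
    \int[mu]_t \sum_(i < n) ((t_ i <= T)%R%:R * excess i t)%:E)%E.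
  rewrite ge0_integral_sum//.
  - apply: eq_bigr => i _; rewrite EFinM -int_excess -ge0_integralZl_EFin//.
    + by move=> t _; rewrite lee_fin.
    + by apply/measurable_EFinP; exact: m_excess.
  - by move=> i; apply/measurable_EFinP; apply: m_scale; exact: m_excess.
  - by move=> i t _; rewrite lee_fin mulr_ge0.
have -> : (((t_ n <= T)%R%:R * ((a0 + T) * T))%:E = \int[mu]_t (last t)%:E)%E.
  rewrite /last; under eq_integral do rewrite EFinM.
  rewrite ge0_integralZl_EFin//; last first.
  - by rewrite mulr_ge0// addr_ge0.
  - by apply/measurable_EFinP; exact: measurable_indic.
  rewrite integral_indic// setIT mulrA [LHS]EFinM; congr (_ * _)%E.
  apply/esym; apply: etrans (lebesgue_measure_itv _) _ => /=; rewrite lte_fin.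
  by case: ltgtP T_ge0 => // [_|<-]; rewrite ?oppr0 ?adde0.
rewrite -ge0_integralD//; last first.
- by apply/measurable_EFinP; apply: m_scale; exact: measurable_indic.
- by move=> t _; rewrite lee_fin.
- under eq_fun do rewrite sumEFin.
  apply/measurable_EFinP; apply: measurable_sum => i; apply: m_scale.
  exact: m_excess.
- by move=> t _; apply: sume_ge0 => i _; rewrite lee_fin mulr_ge0.
apply: ge0_le_integral_nomeas => t _.
  apply: erestrict_ge0 => {}t; rewrite /= in_itv/= lee_fin => /andP[? _].
  exact: age_ge0.
have sum0 : 0 <= \sum_(i < n) (t_ i <= T)%R%:R * excess i t.
  by apply: sumr_ge0 => i _; rewrite mulr_ge0.
rewrite patchE sumEFin -EFinD.
case: ifP => [|_]; last by rewrite lee_fin addr_ge0.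
move=> /[dup] tT'; rewrite inE/= in_itv/= lee_fin => tT.
case: (ltP t (t_ n)) => tn.
  by apply: le_trans (age_le_sum tT tn) _; rewrite lerDl.
rewrite /last indicE tT'; case/andP: tT => t0 tT.
rewrite (le_trans tn tT) mul1r mulr1.
apply: le_trans (age_le_initial X_gt0 S_ge0 a0_ge0 t0) _.
by apply: ler_wpDl => //; rewrite lerD2l.
Qed.

End age_integral.

(** * Renewal estimates *)

Section measurability.
Context d (T : measurableType d) (R : realType).
Implicit Types X S : nat -> T -> R.

Lemma measurable_bool_natr (b : T -> bool) : measurable_fun setT b ->
  measurable_fun setT (fun w => (b w)%:R : R).
Proof.
move=> mb; rewrite (_ : (fun w => _) = (fun w => if b w then 1 else 0)).
  exact: measurable_fun_ifT.
by apply/funext => w; case: (b w).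
Qed.

Lemma measurable_gen_time X n :
  (forall j, (j < n)%N -> measurable_fun setT (X j)) ->
  measurable_fun setT (fun w => gen_time (X ^~ w) n).
Proof. by move=> mX; apply: measurable_sum => i; exact: mX. Qed.

Lemma measurable_stale_age X S a0 n :
  (forall j, (j < n)%N -> measurable_fun setT (X j)) ->
  (forall j, (j < n)%N -> measurable_fun setT (S j)) ->
  measurable_fun setT (fun w => stale_age (X ^~ w) (S ^~ w) a0 n).
Proof.
elim: n => [|n IH] mX mS /=; first exact: measurable_cst.
apply: measurable_funD; first exact: mX.
apply: measurable_fun_ifT => //.
- by apply: measurable_fun_ltr; [exact: mS|exact: mX].
- by apply: IH => j /ltnW; [exact: mX|exact: mS].
Qed.

End measurability.

Section renewal_path.
Context {R : realType}.
Variables (X : nat -> R) (H : R).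
Hypotheses (X_gt0 : forall i, 0 < X i) (H_ge0 : 0 <= H).
Local Notation t_ := (gen_time X).
Local Notation N_ i := ((t_ i <= H)%R%:R : R).

Lemma started_nincr i : N_ i.+1 <= N_ i.
Proof.
case: (leP (t_ i.+1) H) => // h.
by rewrite (le_trans _ h)// gen_time_le.
Qed.

(** The intervals begun by [H] cover the horizon as soon as [t_ n > H]; until then the last term
    pays for all of it. *)
Lemma horizon_le n : H <= \sum_(i < n) N_ i * X i + H * N_ n.
Proof.
suff : Num.min (t_ n) H <= \sum_(i < n) N_ i * X i.
  case: (leP (t_ n) H) => h; rewrite ?mulr1 ?mulr0 ?addr0// => h'.
  by apply: ler_wpDl => //; apply: le_trans h'; exact: gen_time_ge0.
elim: n => [|n IH].
  by rewrite big_ord0 gen_time0 ge_min lexx.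
rewrite big_ord_recr gen_timeS/=.
case: (leP (t_ n) H) IH => h IH.
  by rewrite mul1r ge_min lerD2r IH.
by rewrite mul0r addr0 ge_min IH orbT.
Qed.

(** Only the last interval begun by [H] reaches beyond it, and truncation limits its overshoot to
    [M]. *)
Lemma truncated_sum_le n M : 0 <= M ->
  \sum_(i < n) N_ i * Num.min (X i) M <= H + M.
Proof.
move=> M0.
suff : \sum_(i < n) N_ i * Num.min (X i) M <= Num.min (t_ n) (H + M).
  by rewrite le_min => /andP[].
elim: n => [|n IH].
  by rewrite big_ord0 gen_time0 le_min lexx addr_ge0.
rewrite big_ord_recr gen_timeS/=.
move: IH; rewrite !le_min => /andP[IH IH']; have Xn := X_gt0 n.
have m1 : Num.min (X n) M <= X n by rewrite ge_min lexx.
have m2 : Num.min (X n) M <= M by rewrite ge_min lexx orbT.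
case: (leP (t_ n) H) => h.
  by rewrite mul1r; apply/andP; split; lra.
by rewrite mul0r addr0; apply/andP; split; lra.
Qed.

(** Passing from intervals that end by [H] to intervals that start by [H] adds at most one, which
    straddles [H]. *)
Lemma sum_started_le n M (g : R -> R) : (forall x, 0 < x -> 0 <= g x <= M) ->
  \sum_(i < n) N_ i * g (X i) <= \sum_(i < n) N_ i.+1 * g (X i) + M.
Proof.
move=> gM; have M0 : 0 <= M by case/andP: (gM 1 ltr01) => /le_trans; apply.
(* [1 - N_ n] records whether the straddling interval is among the first [n]. *)
suff : \sum_(i < n) N_ i * g (X i) <=
    \sum_(i < n) N_ i.+1 * g (X i) + M * (1 - N_ n).
  move=> /le_trans; apply; rewrite lerD2l.
  by case: (leP (t_ n) H) => _ /=; lra.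
elim: n => [|n IH].
  by rewrite !big_ord0 gen_time0 H_ge0 subrr mulr0 addr0.
rewrite !big_ord_recr/=; have /andP[g0 gM'] := gM _ (X_gt0 n).
have := started_nincr n; move: IH.
set a := \sum_(i < n) _; set b := \sum_(i < n) _.
case: (t_ n.+1 <= H); case: (t_ n <= H) => /=; rewrite ?(mul0r, mul1r); lra.
Qed.

End renewal_path.

(** Lets the number [n] of packets go to infinity in bounds whose remainder is of order [1 / n]. *)
Lemma le_of_le_add_div (R : realType) (x y z : R) :
  (forall n : nat, x <= y + z / n.+1%:R) -> x <= y.
Proof.
move=> h; rewrite leNgt; apply/negP => yx.
have d0 : 0 < x - y by rewrite subr_gt0.
have := h (Num.truncn (z / (x - y))).
set n := Num.truncn _; have zn : z / (x - y) < n.+1%:R by exact: truncnS_gt.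
rewrite ltr_pdivrMr// in zn.
have n0 : 0 < n.+1%:R :> R by rewrite ltr0n.
move=> xy; have : (x - y) * n.+1%:R <= z.
  by rewrite -ler_pdivlMr// lerBlDl.
by rewrite mulrC leNgt zn.
Qed.

(** * Wald's identity on a fixed horizon *)

Section renewal.
Context d (T : measurableType d) (R : realType) (P : probability T R).
Variables (X S : nat -> {RV P >-> R}) (a0 H : R).
Hypotheses (X_gt0 : forall i w, 0 < X i w) (S_ge0 : forall i w, 0 <= S i w).
Hypotheses (iX : mutually_independent X) (iS : mutually_independent S).
Hypothesis XS : independent_sequences X S.
Hypotheses (a0_ge0 : 0 <= a0) (H_gt0 : 0 < H).

Let H_ge0 : 0 <= H. Proof. exact: ltW. Qed.

Let t_ n w := gen_time (fun i => X i w) n.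
Let N n w : R := (t_ n w <= H)%R%:R.
Let J w := \int[lebesgue_measure]_(t in `[0, H])
  age (fun i => X i w) (fun i => S i w) a0 t.

Definition started_prob n : R :=
  fine (P [set w | gen_time (fun i => X i w) n <= H]).

Let p := started_prob.
(** The expected number of generations by time [H] among the first [n] packets. *)
Let s n := \sum_(i < n) p i.

Let N_ge0 n w : 0 <= N n w. Proof. by []. Qed.

Let measurable_N d' (T' : measurableType d') (Y : nat -> T' -> R) n :
  (forall j, (j < n)%N -> measurable_fun setT (Y j)) ->
  measurable_fun setT
    (fun w => (gen_time (fun i => Y i w) n <= H)%R%:R : R).
Proof.
move=> mY; apply: measurable_bool_natr; apply: measurable_fun_ler => //.
exact: measurable_gen_time.
Qed.

Let mX i : measurable_fun setT (X i).
Proof. exact: measurable_funPT. Qed.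

Let mS i : measurable_fun setT (S i).
Proof. exact: measurable_funPT. Qed.

Let mN n : measurable_fun setT (N n).
Proof. by apply: measurable_N. Qed.

Lemma expectation_started n : ('E_P[N n] = (started_prob n)%:E)%E.
Proof.
have mA : measurable [set w | t_ n w <= H].
  have mle : measurable_fun setT (fun w => t_ n w <= H).
    by apply: measurable_fun_ler => //; exact: measurable_gen_time.
  by have := mle measurableT [set true] I; rewrite setTI.
rewrite /started_prob fineK ?fin_num_measure// -expectation_indic//.
congr expectation; apply/funext => w; rewrite /N indicE.
by congr (nat_of_bool _)%:R; apply/idP/idP; rewrite inE.
Qed.

Let mN_past n k :
  measurable_fun (setT : set (g_sigma_algebraType (past X S n k))) (N n).
Proof.
apply: (@measurable_N _ (g_sigma_algebraType (past X S n k)) (fun i => X i)).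
by move=> j jn; exact: measurable_fun_past.
Qed.

(** [N n] depends on [X 0], ..., [X n.-1] only, hence is independent of [X n]. *)
Lemma expectation_started_mul (f : R -> R) n : measurable_fun setT f ->
  (forall x, 0 <= f x) ->
  ('E_P[(fun w => N n w * f (X n w))%R] = (p n)%:E * 'E_P[f \o X n])%E.
Proof.
move=> mf f0; rewrite /p -expectation_started.
exact: (past_expectation_mul iX XS (@mN_past n 0) mf).
Qed.

Let mNf (f : R -> R) n i : measurable_fun setT f ->
  measurable_fun setT (fun w => N n w * f (X i w)).
Proof.
by move=> mf; apply: measurable_funM; [exact: mN|exact: measurableT_comp].
Qed.

Lemma expectation_started_sum (f : R -> R) n G : measurable_fun setT f ->
  (forall x, 0 <= f x) -> (forall i, 'E_P[f \o X i] = G%:E)%E ->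
  ('E_P[(fun w => \sum_(i < n) N i w * f (X i w))%R] = (s n * G)%:E)%E.
Proof.
move=> mf f0 fG; pose g i w := N i w * f (X i w).
rewrite (@ge0_expectation_sum _ _ _ P n g).
- under eq_bigr do rewrite expectation_started_mul// fG -EFinM.
  by rewrite sumEFin -mulr_suml.
- by move=> i _; exact: mNf.
- by move=> i w; rewrite mulr_ge0.
Qed.

Lemma started_prob_ge0 n : 0 <= p n.
Proof. exact: fine_ge0. Qed.

(** The [p i] are nonincreasing, so [p n] is at most the mean of the previous ones; with a bound on
    [s], it is thus of order [1 / n]. *)
Lemma started_prob_le n : n%:R * p n <= s n.
Proof.
have pS i : p i.+1 <= p i.
  rewrite -lee_fin -!expectation_started; apply: ge0_le_expectation => // w.
  exact: started_nincr.
have pn i : (i <= n)%N -> p n <= p i.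
  elim: n => [|n IH]; first by rewrite leqn0 => /eqP ->.
  by rewrite leq_eqVlt ltnS => /orP[/eqP -> //|/IH]; apply: le_trans.
rewrite -[leLHS]/(n%:R * _) mulr_natl -[X in _ *+ X](card_ord n) -sumr_const.
by apply: ler_sum => i _; exact/pn/ltnW.
Qed.

Variable m : R.
Hypothesis EX : forall i, ('E_P[X i] = m%:E)%E.

Let normX i : (fun w => `|X i w|) = X i.
Proof. by apply/funext => w; rewrite ger0_norm// ltW. Qed.

(** The factorization asks for functions nonnegative on all of [R]; the norm agrees with the
    identity on the positive [X i]. *)
Let EnormX i : ('E_P[Num.norm \o X i] = m%:E)%E.
Proof. by rewrite -(EX i) -[in RHS]normX. Qed.

(** Half of the elementary renewal theorem: up to the term in [p n], the expected number of
    generations is at least [H / m]. *)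
Lemma horizon_le_started n : H <= s n * m + H * p n.
Proof.
rewrite -lee_fin EFinD.
rewrite -(@expectation_started_sum Num.norm n m)//.
rewrite EFinM -expectation_started -ge0_expectationZl//.
rewrite -ge0_expectationD//; last first.
- by move=> w; rewrite mulr_ge0.
- by move=> w; rewrite sumr_ge0// => i _; rewrite mulr_ge0.
- by apply: measurable_funM => //; exact: mN.
- by apply: measurable_sum => i; exact: mNf.
rewrite -[leLHS](expectation_cst P); apply: ge0_le_expectation => // w.
rewrite (eq_bigr (fun i : 'I_n => N i w * X i w)); last first.
  by move=> i _; rewrite ger0_norm// ltW.
exact: horizon_le.
Qed.

(** The converse estimate: the truncated mean [e] replaces [m], so that the overshoot past [H] is at
    most [M]. *)
Lemma started_sum_le n M e : 0 <= M ->
  (forall i, 'E_P[(fun w => Num.min (X i w) M)%R] = e%:E)%E ->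
  s n * e <= H + M.
Proof.
move=> M0 Ee; pose f (x : R) := Num.min `|x| M.
have mf : measurable_fun setT f by exact: measurable_minr.
have fX i : f \o X i = (fun w => Num.min (X i w) M).
  by apply/funext => w; rewrite /f/= ger0_norm// ltW.
have f0 x : 0 <= f x by rewrite le_min normr_ge0.
rewrite -lee_fin -(expectation_started_sum n mf f0); last first.
  by move=> i; rewrite fX.
rewrite -(expectation_cst P); apply: ge0_le_expectation => w.
  by apply: sumr_ge0 => i _; rewrite mulr_ge0.
rewrite (eq_bigr (fun i : 'I_n => N i w * Num.min (X i w) M)); last first.
  by move=> i _; rewrite /f ger0_norm// ltW.
exact: truncated_sum_le.
Qed.

(** Complete intervals carry the weight [N i.+1], which depends on [X i]. Capping [X i ^+ 2 / 2] at
    [C] allows the weight [N i], independent of [X i], at the cost of [C]. *)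
Lemma average_ge_started n C G : 0 <= C ->
  (forall i, 'E_P[(fun w => Num.min (X i w ^+ 2 / 2) C)%R] = G%:E)%E ->
  ((H^-1 * (s n * G - C))%:E <= 'E_P[(fun w => H^-1 * J w)%R])%E.
Proof.
move=> C0 EG; pose f (x : R) := Num.min (x ^+ 2 / 2) C.
have mf : measurable_fun setT f.
  apply: measurable_minr => //; exact: measurable_funM.
have f0 x : 0 <= f x by rewrite le_min C0 andbT divr_ge0// sqr_ge0.
pose Y w := \sum_(i < n) N i.+1 w * f (X i w).
have mY : measurable_fun setT Y by apply: measurable_sum => i; exact: mNf.
have Y0 w : 0 <= Y w by apply: sumr_ge0 => i _; rewrite mulr_ge0.
have YJ w : Y w <= J w.
  apply: (@le_trans _ _ (\sum_(i < n) N i.+1 w * (X i w ^+ 2 / 2))).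
    by apply: ler_sum => i _; rewrite ler_wpM2l// ge_min lexx.
  exact: (@ge_integral_age _ (X ^~ w) (S ^~ w)).
apply: (@le_trans _ _ 'E_P[(fun w => H^-1 * Y w)%R]%E); last first.
  apply: ge0_le_expectation => w; first by rewrite mulr_ge0 ?invr_ge0.
  by rewrite ler_wpM2l ?invr_ge0.
rewrite ge0_expectationZl ?invr_ge0// EFinM lee_wpmul2l ?lee_fin ?invr_ge0//.
rewrite EFinB leeBlDr// -(expectation_cst P C) -ge0_expectationD//.
rewrite -(expectation_started_sum n mf f0 EG); apply: ge0_le_expectation => w.
  by apply: sumr_ge0 => i _; rewrite mulr_ge0.
apply: sum_started_le => // x _; rewrite f0/=.
by rewrite /f ge_min lexx orbT.
Qed.

Lemma average_ge C G : 0 < m -> 0 <= C -> 0 <= G ->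
  (forall i, 'E_P[(fun w => Num.min (X i w ^+ 2 / 2) C)%R] = G%:E)%E ->
  ((G / m - C / H)%:E <= 'E_P[(fun w => H^-1 * J w)%R])%E.
Proof.
move=> m0 C0 G0 EG.
have := fun n => average_ge_started n C0 EG.
case: ('E_P[_])%E => [r||] h; last 2 first.
- by rewrite leey.
- by have := h 0%N; rewrite leNgt ltNyr.
have {}h n : s n * G <= r * H + C.
  have := h n; rewrite lee_fin mulrC ler_pdivrMr//; lra.
have K0 : 0 <= r * H + C.
  apply: le_trans (h 0%N); rewrite mulr_ge0// sumr_ge0// => i _.
  exact: started_prob_ge0.
(* The renewal estimate is multiplied by [G]; since [s n * G] is bounded, the remainder
   [H * (G * p n)] is of order [1 / n] and disappears. *)
have key : H * G <= m * (r * H + C).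
  apply: (@le_of_le_add_div _ _ _ (H * (r * H + C))) => n.
  have := horizon_le_started n.+1; have := started_prob_le n.+1.
  have := h n.+1; set sn := s _; set pn := p _ => h1 h2 h3.
  have n0 : 0 < n.+1%:R :> R by rewrite ltr0n.
  have h4 : G * pn <= (r * H + C) / n.+1%:R.
    rewrite ler_pdivlMr//; apply: le_trans h1.
    by rewrite -mulrA mulrC ler_wpM2r// mulrC.
  apply: (@le_trans _ _ (m * (sn * G) + H * (G * pn))).
    have := ler_wpM2r G0 h3; lra.
  by rewrite -mulrA lerD// ler_wpM2l// ltW.
have : G / m <= (r * H + C) / H.
  by rewrite ler_pdivrMr// mulrAC ler_pdivlMr//; lra.
by rewrite mulrDl mulfK ?gt_eqF// lee_fin; lra.
Qed.

(** * Stale ages and the upper bound for the average *)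

Let D_ n w := stale_age (fun i => X i w) (fun i => S i w) a0 n.
Let ND n w := N n w * D_ n w.

Let D_ge0 n w : 0 <= D_ n w.
Proof. exact: stale_age_ge0. Qed.

Let ND_ge0 n w : 0 <= ND n w.
Proof. by rewrite mulr_ge0. Qed.

(** Both [k = n] and [k = n.+1] are used: the former gives independence from [S n] or from [X n],
    the latter counts [S n] in the past of [X n]. *)
Let mND_past n k : (n <= k)%N ->
  measurable_fun (setT : set (g_sigma_algebraType (past X S n k))) (ND n).
Proof.
move=> nk; apply: measurable_funM; first exact: mN_past.
apply: (@measurable_stale_age _ (g_sigma_algebraType (past X S n k)) _
  (fun i => X i) (fun i => S i)) => j jn.
  exact: measurable_fun_past.
by rewrite pastC; apply: measurable_fun_past; exact: leq_trans jn nk.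
Qed.

Let mND n : measurable_fun setT (ND n).
Proof. exact: (past_measurable_fun (@mND_past n n (leqnn n))). Qed.

Variables (delta q1 q2 m2 : R).
Hypothesis delta_ge0 : 0 <= delta.
Hypothesis ES : forall i, ('E_P[(fun w => (delta < S i w)%R%:R)%R] = q1%:E)%E.
Hypothesis EXd : forall i, ('E_P[(fun w => (X i w <= delta)%R%:R)%R] = q2%:E)%E.
Hypothesis EX2 : forall i, ('E_P[(fun w => X i w ^+ 2)%R] = m2%:E)%E.

Let gtd (x : R) : R := (delta < x)%R%:R.
Let led (x : R) : R := (x <= delta)%R%:R.

Let mgtd : measurable_fun setT gtd.
Proof. by apply: measurable_bool_natr; exact: measurable_fun_ltr. Qed.

Let mled : measurable_fun setT led.
Proof. by apply: measurable_bool_natr; exact: measurable_fun_ler. Qed.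

Let gtd_ge0 x : 0 <= gtd x. Proof. by []. Qed.
Let led_ge0 x : 0 <= led x. Proof. by []. Qed.

Let q1_ge0 : 0 <= q1.
Proof. by rewrite -lee_fin -(ES 0); exact: expectation_ge0. Qed.

Let q2_ge0 : 0 <= q2.
Proof. by rewrite -lee_fin -(EXd 0); exact: expectation_ge0. Qed.

Let m_ge0 : 0 <= m.
Proof.
by rewrite -lee_fin -(EX 0); apply: expectation_ge0 => w; exact: ltW.
Qed.

Let m2_ge0 : 0 <= m2.
Proof.
by rewrite -lee_fin -(EX2 0); apply: expectation_ge0 => w; exact: sqr_ge0.
Qed.

Let ENDgtd n : ('E_P[(fun w => ND n w * gtd (S n w))%R] = 'E_P[ND n] * q1%:E)%E.
Proof.
rewrite -(ES n); have mh := @mND_past n n (leqnn n); rewrite pastC in mh.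
exact: (past_expectation_mul iS (independent_sequencesC XS) mh mgtd).
Qed.

Let ENDled n : ('E_P[(fun w => ND n w * led (X n w))%R] = 'E_P[ND n] * q2%:E)%E.
Proof.
rewrite -(EXd n); have mh := @mND_past n n (leqnn n).
exact: (past_expectation_mul iX XS mh mled).
Qed.

Let mNDgtd n : measurable_fun setT (fun w => ND n w * gtd (S n w)).
Proof. by apply: measurable_funM; [exact: mND|exact: measurableT_comp]. Qed.

Let mNDled n : measurable_fun setT (fun w => ND n w * led (X n w)).
Proof. by apply: measurable_funM; [exact: mND|exact: measurableT_comp]. Qed.

Let ENDgtdX n : ('E_P[(fun w => ND n w * gtd (S n w) * X n w)%R] =
  'E_P[ND n] * q1%:E * m%:E)%E.
Proof.
rewrite -ENDgtd -(EnormX n).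
have mh : measurable_fun (setT : set (g_sigma_algebraType (past X S n n.+1)))
    (fun w => ND n w * gtd (S n w)).
  apply: measurable_funM; first exact: mND_past.
  apply: measurableT_comp => //; rewrite pastC.
  exact: measurable_fun_past.
rewrite -(past_expectation_mul (f := Num.norm) iX XS mh)//; last first.
  by move=> w; rewrite mulr_ge0.
by congr expectation; apply/funext => w; rewrite ger0_norm// ltW.
Qed.

(** The expected stale age on the event that packet [n] is generated by [H] obeys this recursion as
    an inequality, [q1 + q2] bounding the probability of preemption. *)
Fixpoint stale_bound n : R :=
  if n is k.+1 then p k * m + (q1 + q2) * stale_bound k else a0.

Let r := stale_bound.

Let r_ge0 n : 0 <= r n.
Proof.
elim: n => [//|n IH]; rewrite /r/= addr_ge0// mulr_ge0//.
  exact: started_prob_ge0.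
exact: addr_ge0.
Qed.

(** The recursion summed over the packets; for [q1 + q2 < 1] it bounds the total stale age by a
    multiple of [a0 + s n * m]. *)
Lemma sum_stale_bound n :
  (1 - (q1 + q2)) * (\sum_(i < n) r i) + r n = a0 + s n * m.
Proof.
elim: n => [|n IH]; first by rewrite /s !big_ord0 mulr0 mul0r addr0 add0r.
rewrite /s !big_ord_recr/= -/(s n) -/(r n); move: IH.
by set u := \sum_(i < n) _ => IH; rewrite /r/= -/r; lra.
Qed.

Lemma expectation_stale_le n : ('E_P[ND n] <= (r n)%:E)%E.
Proof.
elim: n => [|n IH].
  rewrite -(expectation_cst P); apply: ge0_le_expectation => // w.
  by rewrite /ND /D_/= ler_piMl// /N; case: (leP (t_ 0 w) H).
pose Z w := N n w * X n w + ND n w * gtd (S n w) + ND n w * led (X n w).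
apply: (@le_trans _ _ 'E_P[Z]%E).
  apply: ge0_le_expectation => // w.
  rewrite /Z -addrA -!mulrDr /ND -mulrA -mulrDr.
  apply: ler_pM => //; first exact: started_nincr.
  rewrite /D_/= lerD2l -/(D_ n w); case: ltP => SX.
    by rewrite mulr_ge0 ?addr_ge0.
  rewrite ler_peMr//.
  (* Here [X n <= S n], which forces [X n <= delta] or [delta < S n]. *)
  rewrite /gtd /led; case: (leP (X n w) delta) => XD.
    by rewrite lerDr.
  by rewrite (lt_le_trans XD SX) addr0.
have mNX : measurable_fun setT (fun w => N n w * X n w).
  by apply: measurable_funM.
have NX0 w : 0 <= N n w * X n w by rewrite mulr_ge0// ltW.
rewrite ge0_expectationD//; last 3 first.
- exact: measurable_funD.
- by move=> w; rewrite addr_ge0// mulr_ge0.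
- by move=> w; rewrite mulr_ge0.
rewrite ge0_expectationD//; last by move=> w; rewrite mulr_ge0.
rewrite ENDgtd ENDled -addeA -ge0_muleDr ?lee_fin//.
have -> : ('E_P[(fun w => N n w * X n w)%R] = (p n * m)%:E)%E.
  rewrite EFinM -(EnormX n) -expectation_started_mul//.
  by congr expectation; apply/funext => w; rewrite ger0_norm// ltW.
rewrite [r _]/= EFinD leeD2l// muleC EFinM.
by rewrite lee_wpmul2l// lee_fin addr_ge0.
Qed.

(** Bounds the mean of the minimum of [S n] and [X n], which is at most [delta], plus [X n] on the
    event [delta < S n]. *)
Let eps := delta + q1 * m.

Lemma expectation_excess_le n :
  ('E_P[(fun w => ND n w * Num.min (S n w) (X n w))%R] <= (r n * eps)%:E)%E.
Proof.
pose Z w := delta * ND n w + ND n w * gtd (S n w) * X n w.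
apply: (@le_trans _ _ 'E_P[Z]%E).
  apply: ge0_le_expectation => w.
    by rewrite mulr_ge0// le_min S_ge0 ltW.
  rewrite [leRHS](_ : _ = (gtd (S n w) * X n w + delta) * ND n w); last first.
    by rewrite /Z; ring.
  rewrite mulrC ler_wpM2r// /gtd; case: (ltP delta (S n w)) => Sd.
    rewrite mul1r; apply: (@le_trans _ _ (X n w)); last by rewrite lerDl.
    by rewrite ge_min lexx orbT.
  by rewrite mul0r add0r ge_min Sd.
rewrite ge0_expectationD//; last 4 first.
- by apply: measurable_funM => //; exact: mND.
- by apply: measurable_funM => //; exact: mNDgtd.
- by move=> w; rewrite mulr_ge0.
- by move=> w; rewrite !mulr_ge0// ltW.
rewrite ge0_expectationZl// ENDgtdX muleC -muleA.
rewrite -ge0_muleDr ?lee_fin//; last first.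
  exact: mulr_ge0.
rewrite -EFinM -EFinD [(r n * _)%:E]EFinM lee_wpmul2r//.
  by rewrite lee_fin addr_ge0// mulr_ge0.
exact: expectation_stale_le.
Qed.

Lemma average_le_started n :
  ('E_P[(fun w => H^-1 * J w)%R] <=
   (H^-1 * (s n * (m2 / 2) + (\sum_(i < n) r i) * eps +
            p n * ((a0 + H) * H)))%:E)%E.
Proof.
pose f (x : R) := x ^+ 2 / 2.
pose W1 w := \sum_(i < n) N i w * f (X i w).
pose W2 w := \sum_(i < n) ND i w * Num.min (S i w) (X i w).
pose W3 w := (a0 + H) * H * N n w.
have mf : measurable_fun setT f by exact: measurable_funM.
have f0 x : 0 <= f x by rewrite divr_ge0// sqr_ge0.
have c0 : 0 <= (a0 + H) * H by rewrite mulr_ge0// addr_ge0.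
have min0 i w : 0 <= Num.min (S i w) (X i w) by rewrite le_min S_ge0 ltW.
have mW1 : measurable_fun setT W1 by apply: measurable_sum => i; exact: mNf.
have mW2i i : measurable_fun setT (fun w => ND i w * Num.min (S i w) (X i w)).
  by apply: measurable_funM; [exact: mND|exact: measurable_minr].
have mW2 : measurable_fun setT W2 by apply: measurable_sum => i; exact: mW2i.
have mW3 : measurable_fun setT W3 by apply: measurable_funM => //; exact: mN.
have W10 w : 0 <= W1 w by apply: sumr_ge0 => i _; rewrite mulr_ge0.
have W20 w : 0 <= W2 w by apply: sumr_ge0 => i _; rewrite mulr_ge0.
have W30 w : 0 <= W3 w by rewrite mulr_ge0.
have J0 w : 0 <= J w.
  have := @ge_integral_age _ (X ^~ w) (S ^~ w) a0 H (X_gt0 ^~ w)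
    (S_ge0 ^~ w) a0_ge0 0%N.
  by rewrite big_ord0.
have JW w : J w <= W1 w + W2 w + W3 w.
  apply: le_trans (@integral_age_le _ (X ^~ w) (S ^~ w) a0 H (X_gt0 ^~ w)
    (S_ge0 ^~ w) a0_ge0 H_ge0 n) _.
  rewrite [W3 w]mulrC lerD2r -big_split/=; apply: ler_sum => i _.
  by rewrite mulrDr [X in _ + X]mulrA.
apply: (@le_trans _ _ 'E_P[(fun w => H^-1 * (W1 w + W2 w + W3 w))%R]%E).
  apply: ge0_le_expectation => w; first by rewrite mulr_ge0 ?invr_ge0.
  by rewrite ler_wpM2l ?invr_ge0.
rewrite ge0_expectationZl ?invr_ge0//; last 2 first.
- by do 2 apply: measurable_funD => //.
- by move=> w; rewrite !addr_ge0.
rewrite [leRHS]EFinM lee_wpmul2l ?lee_fin ?invr_ge0//.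
rewrite ge0_expectationD//; last 2 first.
- exact: measurable_funD.
- by move=> w; rewrite addr_ge0.
have -> : ('E_P[W3] = ((a0 + H) * H)%:E * (p n)%:E)%E.
  by rewrite ge0_expectationZl// expectation_started.
rewrite ge0_expectationD// 2!EFinD; apply: leeD; last by rewrite -EFinM mulrC.
apply: leeD.
  rewrite (@expectation_started_sum f n (m2 / 2))// => i.
  have -> : f \o X i = (fun w => 2^-1 * X i w ^+ 2).
    by apply/funext => w; rewrite /f/= mulrC.
  rewrite ge0_expectationZl.
  - by rewrite EX2 -EFinM mulrC.
  - exact: measurable_funX.
  - by move=> w; exact: sqr_ge0.
  - by [].
pose g i w := ND i w * Num.min (S i w) (X i w).
rewrite /W2 (@ge0_expectation_sum _ _ _ P n g); last 2 first.
- by move=> i _; exact: mW2i.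
- by move=> i w; rewrite /g mulr_ge0.
rewrite mulr_suml -sumEFin; apply: lee_sum => i _.
exact: expectation_excess_le.
Qed.

(** The bound [s n <= (H + M) / e] is uniform in [n]. It controls the stale ages through
    [sum_stale_bound] and makes the term in [p n] vanish as [n] grows. *)
Lemma average_le M e : 0 <= M -> 0 < e -> q1 + q2 < 1 ->
  (forall i, 'E_P[(fun w => Num.min (X i w) M)%R] = e%:E)%E ->
  ('E_P[(fun w => H^-1 * J w)%R] <=
   (H^-1 * ((H + M) / e * (m2 / 2) +
            (a0 + (H + M) / e * m) / (1 - (q1 + q2)) * eps))%:E)%E.
Proof.
move=> M0 e0 q1q2 Ee; pose K := (H + M) / e.
have q0 : 0 < 1 - (q1 + q2) by rewrite subr_gt0.
have eps0 : 0 <= eps by rewrite addr_ge0// mulr_ge0.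
have K0 : 0 <= K by rewrite divr_ge0 ?addr_ge0// ltW.
have sK n : s n <= K by rewrite ler_pdivlMr//; exact: started_sum_le.
have rK n : \sum_(i < n) r i <= (a0 + K * m) / (1 - (q1 + q2)).
  rewrite ler_pdivlMr// mulrC; have := sum_stale_bound n.
  by have := r_ge0 n; have := ler_wpM2r m_ge0 (sK n); lra.
have a0H : 0 <= (a0 + H) * H by rewrite mulr_ge0// addr_ge0.
have bound n : ('E_P[(fun w => H^-1 * J w)%R] <=
    (H^-1 * (K * (m2 / 2) + (a0 + K * m) / (1 - (q1 + q2)) * eps) +
     (H^-1 * (K * ((a0 + H) * H))) / n.+1%:R)%:E)%E.
  apply: le_trans (average_le_started n.+1) _.
  rewrite lee_fin -[H^-1 * _ / _]mulrA -mulrDr ler_wpM2l ?invr_ge0// lerD//.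
    by rewrite lerD// ler_wpM2r// divr_ge0.
  rewrite mulrAC ler_wpM2r// ler_pdivlMr ?ltr0n// mulrC.
  exact: le_trans (started_prob_le _) (sK _).
have := bound 0%N; case: ('E_P[_])%E bound => [x||] bound _; last 2 first.
- by have := bound 0%N; rewrite leye_eq.
- by rewrite leNye.
rewrite lee_fin; apply: le_of_le_add_div => n.
by rewrite -lee_fin; exact: bound.
Qed.

End renewal.

(** * The average age *)

Section law_expectation.
Context d (T : measurableType d) (R : realType) (P : probability T R).
Local Open Scope ereal_scope.

Lemma has_law_ge0_integral (Y : {RV P >-> R}) (F : probability R R)
    (f : R -> \bar R) : has_law Y F ->
  measurable_fun setT f -> (forall x, 0 <= f x) ->
  \int[F]_x f x = \int[P]_w f (Y w).
Proof.
move=> YF mf f0; rewrite -[RHS]/(\int[P]_(w in setT) (f \o Y) w).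
rewrite -[X in \int[P]_(w in X) _](preimage_setT Y).
rewrite -(@ge0_integral_pushforward _ _ _ _ _ Y)//.
by apply: eq_measure_integral => /= A mA _; rewrite -YF.
Qed.

Lemma has_law_expectation (Y : {RV P >-> R}) (F : probability R R)
    (f : R -> R) : has_law Y F -> measurable_fun setT f ->
  'E_P[f \o Y] = 'E_F[f].
Proof.
move=> YF mf; have mEf : measurable_fun setT (EFin \o f).
  exact/measurable_EFinP.
rewrite unlock [LHS]integralE [RHS]integralE; congr (_ - _).
  rewrite (has_law_ge0_integral YF)//; last exact: measurable_funepos.
  by apply: eq_integral => w _; rewrite !funeposE.
rewrite (has_law_ge0_integral YF)//; last exact: measurable_funeneg.
by apply: eq_integral => w _; rewrite !funenegE.
Qed.

(** Monotone convergence for the truncations of [f]; an infinite mean is allowed. *)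
Lemma expectation_min_gt (f : T -> R) (c : \bar R) :
  measurable_fun setT f -> (forall w, 0 <= f w)%R -> c < 'E_P[f] ->
  exists n : nat, c < 'E_P[(fun w => Num.min (f w) n%:R)%R].
Proof.
move=> mf f0 cf; apply/not_existsP => nc.
pose g n w := (Num.min (f w) n%:R)%:E.
have mg n : measurable_fun setT (g n).
  by apply/measurable_EFinP; exact: measurable_minr.
have g0 n w : setT w -> 0 <= g n w by move=> _; rewrite lee_fin le_min f0/=.
have ndg w : setT w -> nondecreasing_seq (g ^~ w).
  move=> _ a b ab; rewrite lee_fin le_min !ge_min lexx/=.
  by rewrite ler_nat ab orbT.
have fE : \int[P]_w limn (g ^~ w) = 'E_P[f].
  rewrite unlock; apply: eq_integral => w _; apply/cvg_lim => //.
  apply: cvg_near_cst; exists (Num.truncn (f w)).+1 => // n /= fn.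
  rewrite /g min_l//; apply: ltW; apply: lt_le_trans (truncnS_gt _) _.
  by rewrite ler_nat.
have cg : \int[P]_w g n w @[n --> \oo] --> 'E_P[f].
  by rewrite -fE; exact: cvg_monotone_convergence.
move: cf; rewrite ltNge => /negP; apply.
rewrite -(cvg_lim _ cg)//; apply: lime_le.
  by apply/cvg_ex; exists ('E_P[f]).
by apply: nearW => n; have /negP := nc n; rewrite -leNgt unlock.
Qed.

End law_expectation.

Lemma has_law_expectation_indic d (T : measurableType d) (R : realType)
    (P : probability T R) (Y : {RV P >-> R}) (F : probability R R)
    (b : R -> bool) : has_law Y F -> measurable [set x | b x] ->
  ('E_P[(fun w => (b (Y w))%:R)%R] = F [set x | b x])%E.
Proof.
move=> YF mb; rewrite -YF// -expectation_indic; last exact: measurable_funPTI.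
congr expectation; apply/funext => w; rewrite indicE; congr (nat_of_bool _)%:R.
by apply/idP/idP; rewrite inE.
Qed.

Section queue.
Context {R : realType} {FX : probability R R} (lambda a0 : R).
Hypotheses (lambda_gt0 : 0 < lambda) (a0_ge0 : 0 <= a0).
Hypothesis mean_FX : law_mean FX = (lambda^-1)%:E.

Section single_queue.
Context {FS : probability R R} (Q : gg1_queue FX FS).
Local Notation P := (gg1_prob Q).
Local Notation X := (gg1_X Q).
Local Notation S := (gg1_S Q).

Lemma gg1_X_expectation (f : R -> R) i : measurable_fun setT f ->
  ('E_P[f \o X i] = 'E_FX[f])%E.
Proof. by move=> mf; apply: has_law_expectation => //; exact: gg1_X_law. Qed.

Lemma gg1_X_mean i : ('E_P[X i] = (lambda^-1)%:E)%E.
Proof. by rewrite -mean_FX /law_mean -(gg1_X_expectation i). Qed.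

Lemma gg1_X_half_sqr i : ('E_P[(fun w => X i w ^+ 2 / 2)%R] =
  (2^-1)%:E * law_moment2 FX)%E.
Proof.
rewrite /law_moment2 -(gg1_X_expectation i (f := fun x => x ^+ 2)).
rewrite -ge0_expectationZl//.
- by congr expectation; apply/funext => w /=; rewrite mulrC.
- by apply: measurableT_comp.
- by move=> w; exact: sqr_ge0.
- exact: exprn_measurable.
Qed.

Lemma age_boundE : age_bound FX = (lambda%:E * ((2^-1)%:E * law_moment2 FX))%E.
Proof.
rewrite /age_bound mean_FX inver invr_eq0 gt_eqF//= invrK.
by rewrite muleA [RHS]muleC.
Qed.

Lemma expectation_min_fin_num (f : gg1_space Q -> R) (C : R) : 0 <= C ->
  (forall w, 0 <= f w) ->
  'E_P[(fun w => Num.min (f w) C)%R]%E \is a fin_num.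
Proof.
move=> C0 f0; rewrite ge0_fin_numE; last first.
  by apply: expectation_ge0 => w; rewrite le_min f0.
apply: (@le_lt_trans _ _ C%:E); last exact: ltry.
rewrite -(expectation_cst P); apply: ge0_le_expectation => w.
  by rewrite le_min f0.
by rewrite ge_min lexx orbT.
Qed.

Let average (H : R) := ('E_P[fun w =>
  (H^-1 * \int[lebesgue_measure]_(t in `[0%R, H]) queue_age a0 t w)%R])%E.

(** Otherwise the averages beyond some [A] are at most a [c] smaller than the bound. A capped mean
    [G] of [X ^+ 2 / 2] still has [G * lambda > c], and the cost [n / H] of the cap vanishes on long
    horizons. *)
Lemma age_bound_le_average_age : (age_bound FX <= average_age a0 Q)%E.
Proof.
rewrite /average_age limf_esupE; apply: le_ereal_inf_tmp => _ [V [A [_ AV]] <-].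
rewrite -/average leNgt; apply/negP => bB.
have fb H : A < H -> (average H <= ereal_sup (average @` V))%E.
  by move=> /AV VH; apply: ereal_sup_ubound; exists H.
set b := ereal_sup _ in bB fb.
(* [b] is not [+oo], being below the bound, nor [-oo], since averages over positive horizons are
   nonnegative. *)
have [c bE] : exists c, b = c%:E.
  case: b bB fb => [c| |] bB fb; first by exists c.
    by rewrite ltNge leey in bB.
  have H0 : 0 < `|A| + 1 by have := normr_ge0 A; lra.
  have AA : A < `|A| + 1 by have := ler_norm A; lra.
  have := fb _ AA; rewrite leNgt.
  rewrite (lt_le_trans (ltNyr 0))//; apply: expectation_ge0 => w.
  rewrite mulr_ge0 ?invr_ge0 ?(ltW H0)// fine_ge0// integral_ge0// => t.
  rewrite /= in_itv/= lee_fin => /andP[t0 _]; apply: age_ge0 => //.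
  - by move=> i; exact: gg1_X_gt0.
  - by move=> i; exact: gg1_S_ge0.
rewrite bE in bB fb.
have cE : ((c / lambda)%:E < 'E_P[(fun w => X 0%N w ^+ 2 / 2)%R])%E.
  move: bB; rewrite age_boundE -(gg1_X_half_sqr 0).
  case: ('E_P[_])%E => [x||].
  - by rewrite -EFinM !lte_fin ltr_pdivrMr// mulrC.
  - by rewrite ltry.
  - by rewrite gt0_muleNy// ltNge leNye.
have [||n] := expectation_min_gt _ _ cE.
- by apply: measurable_funM => //; exact: measurable_funX.
- by move=> w; rewrite divr_ge0// sqr_ge0.
set EG := 'E_P[_]%E => cG.
have EGfin : EG \is a fin_num.
  by apply: expectation_min_fin_num => // w; rewrite divr_ge0// sqr_ge0.
have EG0 : 0 <= fine EG.
  rewrite fine_ge0// expectation_ge0// => w.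
  by rewrite le_min ler0n andbT divr_ge0// sqr_ge0.
have EGi i :
    ('E_P[(fun w => Num.min (X i w ^+ 2 / 2) n%:R)%R] = (fine EG)%:E)%E.
  rewrite fineK// /EG.
  have mf : measurable_fun setT (fun x : R => Num.min (x ^+ 2 / 2) n%:R).
    by apply: measurable_minr => //; apply: measurable_funM.
  by rewrite (gg1_X_expectation i mf) (gg1_X_expectation 0 mf).
rewrite -(fineK EGfin) lte_fin ltr_pdivrMr// in cG.
set G := fine EG in cG EG0 EGi.
(* A horizon beyond [A] with [n / H < G * lambda - c]. *)
pose H := `|A| + 1 + n%:R / (G * lambda - c).
have d0 : 0 < G * lambda - c by rewrite subr_gt0.
have nd0 : 0 <= n%:R / (G * lambda - c) by rewrite divr_ge0// ltW.
have AH : A < H by have := ler_norm A; rewrite /H; lra.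
have H0 : 0 < H by have := normr_ge0 A; rewrite /H; lra.
have m0 : 0 < lambda^-1 by rewrite invr_gt0.
have := average_ge (gg1_X_gt0 (g := Q)) (gg1_S_ge0 (g := Q)) (gg1_X_indep Q)
  (gg1_XS_indep Q) a0_ge0 H0 gg1_X_mean m0 (ler0n R n) EG0 EGi.
move=> /le_trans /(_ (fb _ AH)); rewrite lee_fin invrK leNgt => /negP; apply.
suff : n%:R / H < G * lambda - c by lra.
rewrite ltr_pdivrMr// mulrC -ltr_pdivrMr// /H.
by have := normr_ge0 A; lra.
Qed.

Lemma average_age_le (M delta m2 e q1 q2 eta : R) : 0 <= M -> 0 < e ->
  0 <= delta -> q1 + q2 < 1 -> 0 < eta ->
  ('E_FX[(fun x => Num.min x M)%R] = e%:E)%E ->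
  law_moment2 FX = m2%:E ->
  (FS [set` `]delta, +oo[] = q1%:E)%E -> (FX [set` `]-oo, delta]] = q2%:E)%E ->
  (average_age a0 Q <= (e^-1 * (m2 / 2 + lambda^-1 / (1 - (q1 + q2)) *
     (delta + q1 * lambda^-1)) + eta)%:E)%E.
Proof.
move=> M0 e0 delta0 q1q2 eta0 Ee Em2 FSq1 FXq2.
set m := lambda^-1; set eps := delta + q1 * m; set q := 1 - (q1 + q2).
(* [c] collects the terms that do not grow with the horizon; beyond [H0] their share [c / H] is
   below [eta]. *)
pose c := M / e * (m2 / 2) + (a0 + M / e * m) / q * eps.
pose H0 := Num.max 1 (c / eta).
rewrite /average_age limf_esupE; apply: ge_ereal_inf.
exists (ereal_sup (average @` [set` `]H0, +oo[])).
  exists [set` `]H0, +oo[] => //; exists H0; split; first exact: num_real.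
  by move=> x /= H0x; rewrite in_itv/= H0x.
apply: ge_ereal_sup => _ [H /= H0H <-]; rewrite in_itv/= andbT in H0H.
have H1 : 0 < H by apply: lt_trans H0H; rewrite lt_max ltr01.
have cH : c < eta * H.
  by move: H0H; rewrite /H0 gt_max ltr_pdivrMr// mulrC => /andP[].
have minE i : ('E_P[(fun w => Num.min (X i w) M)%R] = e%:E)%E.
  by rewrite -Ee -(gg1_X_expectation i)//; exact: measurable_minr.
have EX2 i : ('E_P[(fun w => X i w ^+ 2)%R] = m2%:E)%E.
  by rewrite -Em2 /law_moment2 -(gg1_X_expectation i).
have setoy : [set x | delta < x] = [set` `]delta, +oo[].
  by apply/seteqP; split => x /=; rewrite in_itv/= andbT.
have setNyc : [set x | x <= delta] = [set` `]-oo, delta]].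
  by apply/seteqP; split => x /=; rewrite in_itv/=.
have ESd i : ('E_P[(fun w => (delta < S i w)%R%:R)%R] = q1%:E)%E.
  pose b x := delta < x.
  by rewrite (has_law_expectation_indic (b := b) (gg1_S_law Q i)) ?setoy.
have EXd i : ('E_P[(fun w => (X i w <= delta)%R%:R)%R] = q2%:E)%E.
  pose b x := x <= delta.
  by rewrite (has_law_expectation_indic (b := b) (gg1_X_law Q i)) ?setNyc.
have := average_le (gg1_X_gt0 (g := Q)) (gg1_S_ge0 (g := Q)) (gg1_X_indep Q)
  (gg1_S_indep Q) (gg1_XS_indep Q) a0_ge0 H1 gg1_X_mean delta0 ESd EXd EX2
  M0 e0 q1q2 minE.
move=> /le_trans; apply; rewrite lee_fin -/m -/q -/eps.
have -> : (H + M) / e * (m2 / 2) + (a0 + (H + M) / e * m) / q * eps =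
    H * (e^-1 * (m2 / 2 + m / q * eps)) + c.
  rewrite /c; ring.
rewrite mulrDr mulKf ?gt_eqF// lerD2l ler_pdivrMl// mulrC.
exact: ltW.
Qed.

End single_queue.
(** The law of [X] alone fixes a truncated mean [e] close to [m] and a small [delta] with
    [P (X <= delta) < 1 / 4]; only then does the tail hypothesis make [q1] small. *)
Lemma average_age_cvg (I : Type) (F : set_system I) {FF : ProperFilter F}
    (FS : I -> probability R R) (Q : forall a, gg1_queue FX (FS a)) :
  (forall delta eps : R, 0 < delta -> 0 < eps ->
    \forall a \near F, (FS a [set` `]delta, +oo[] <= eps%:E)%E) ->
  average_age a0 (Q a) @[a --> F] --> age_bound FX.
Proof.
(* The queue at one index [a1] supplies a variable of law [FX], on which facts about [FX] are
   read. *)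
move=> tail; have [a1 _] := filter_ex (@filterT _ F _).
have lower a := age_bound_le_average_age (Q a).
have boundE := age_boundE.
have m2_ge0 : (0 <= law_moment2 FX)%E.
  by apply: expectation_ge0 => x; exact: sqr_ge0.
(* With an infinite second moment, the lower bound already makes every average age [+oo]. *)
case m2E : (law_moment2 FX) m2_ge0 => [m2| |//] m2_ge0; last first.
  have by_ : age_bound FX = +oo%E.
    by rewrite boundE m2E gt0_muley// gt0_muley// lte_fin.
  rewrite by_ (_ : (fun a => _) = cst +oo%E); first exact: cvg_cst.
  by apply/funext => a; apply/eqP; rewrite -leye_eq -by_.
rewrite lee_fin in m2_ge0.
pose B := lambda * (m2 / 2).
have BE : age_bound FX = B%:E by rewrite boundE m2E -!EFinM /B [m2 / 2]mulrC.
have B0 : 0 <= B by rewrite mulr_ge0 ?divr_ge0// ltW.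
rewrite BE; suff upper eta : 0 < eta ->
    \forall a \near F, (average_age a0 (Q a) <= (B + eta)%:E)%E.
  apply/fine_cvgP; split.
    near=> a; rewrite fin_numElt (lt_le_trans (ltNyr B)) -?BE//=.
    apply: (@le_lt_trans _ _ (B + 1)%:E); last exact: ltry.
    by near: a; exact: upper.
  apply/cvgrPdist_le => eta eta0; near=> a.
  have : (average_age a0 (Q a) <= (B + eta)%:E)%E by near: a; exact: upper.
  have := lower a; rewrite BE /=; case: (average_age a0 (Q a)) => [x| |]//=.
  rewrite !lee_fin => Bx xB; rewrite ler0_norm ?subr_le0// opprB; lra.
move=> eta0.
set m := lambda^-1; have m0 : 0 < m by rewrite invr_gt0.
have mB : m2 / 2 = B * m by rewrite /B mulrAC divff ?gt_eqF// mul1r.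
pose eta' := eta / 2; have eta'0 : 0 < eta' by rewrite divr_gt0.
have Beta0 : 0 < B + eta' by lra.
(* Solves [e0 * (B + eta') = m * (B + eta' / 2)]: as [m2 / 2 = B * m], this leaves [m * eta' / 2]
   for the stale ages. *)
pose e0 := m * (B + eta' / 2) / (B + eta').
have e00 : 0 < e0 by rewrite divr_gt0// mulr_gt0//; lra.
have e0m : (e0%:E < 'E_(gg1_prob (Q a1))[gg1_X (Q a1) 0%N])%E.
  by rewrite gg1_X_mean lte_fin ltr_pdivrMr// ltr_pM2l//; lra.
have [||n] := expectation_min_gt _ _ e0m.
- by [].
- by move=> w; apply: ltW; exact: gg1_X_gt0.
set e' := 'E_(_)[_]%E => e0e'.
have e'fin : e' \is a fin_num.
  by apply: expectation_min_fin_num => // w; apply: ltW; exact: gg1_X_gt0.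
pose e := fine e'; have e'E : e' = e%:E by rewrite fineK.
have e0e : e0 < e by rewrite -lte_fin -e'E.
have Ee : ('E_FX[(fun x => Num.min x n%:R)%R] = e%:E)%E.
  rewrite -e'E /e' -(gg1_X_expectation (Q a1) 0)//.
  exact: measurable_minr.
(* As [X > 0], right continuity of its distribution function at 0 makes [P (X <= delta)] small. *)
have cdf0 : cdf (gg1_X (Q a1) 0%N) 0 = 0%E.
  rewrite -[LHS]/(gg1_prob (Q a1) (gg1_X (Q a1) 0%N @^-1` [set` `]-oo, 0%R]])).
  rewrite (_ : _ @^-1` _ = set0) ?measure0//.
  apply/seteqP; split => // w /=; rewrite in_itv/= leNgt.
  by rewrite gg1_X_gt0.
have := @cdf_right_continuous _ _ _ _ (gg1_X (Q a1) 0%N) 0.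
rewrite cdf0 => /fine_cvgP[_] /cvgrPdist_lt /(_ (1 / 4)) cdf4.
have [delta [delta0 deltaeta qd]] : exists delta : R, [/\ 0 < delta,
    delta < eta' / 8 & fine (FX [set` `]-oo, delta]]) < 1 / 4].
  near (0 : R)^'+ => delta; exists delta; split.
  - by near: delta; exact: nbhs_right_gt.
  - by near: delta; apply: nbhs_right_lt; rewrite divr_gt0.
  - rewrite -(gg1_X_law (Q a1) 0)//.
    have : `|0 - fine (cdf (gg1_X (Q a1) 0%N) delta)| < 1 / 4.
      by near: delta; apply: cdf4; rewrite divr_gt0.
    rewrite sub0r normrN => /(le_lt_trans (ler_norm _)).
    by rewrite /cdf/=.
set q2 := fine (FX _) in qd.
have q2E : (FX [set` `]-oo, delta]] = q2%:E)%E.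
  by rewrite fineK ?fin_num_measure.
(* The first bound gives [1 - (q1 + q2) >= 1 / 2], the second [q1 * m <= eta' / 8]. *)
pose eps := Num.min (1 / 4) (lambda * (eta' / 8)).
have eps0 : 0 < eps by rewrite lt_min divr_gt0//= mulr_gt0// divr_gt0.
apply: filterS (tail delta eps delta0 eps0) => a tail_a.
pose q1 := fine (FS a [set` `]delta, +oo[]).
have q1E : (FS a [set` `]delta, +oo[] = q1%:E)%E.
  by rewrite fineK ?fin_num_measure.
have q1_ge0 : 0 <= q1 by exact: fine_ge0.
have q2_ge0 : 0 <= q2 by exact: fine_ge0.
move: tail_a; rewrite q1E lee_fin le_min => /andP[q14 q1eta].
have q12 : q1 + q2 < 1 by lra.
have := average_age_le (Q a) (ler0n R n) (lt_trans e00 e0e) (ltW delta0) q12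
  eta'0 Ee m2E q1E q2E.
move=> /le_trans; apply; rewrite lee_fin -/m.
suff : e^-1 * (m2 / 2 + m / (1 - (q1 + q2)) * (delta + q1 * m)) <= B + eta'.
  by rewrite /eta'; lra.
rewrite ler_pdivrMl ?(lt_trans e00)// mB.
have q1m : q1 * m <= eta' / 8 by rewrite /m ler_pdivrMr// mulrC.
have mq : m / (1 - (q1 + q2)) <= m * 2.
  by rewrite ler_wpM2l ?(ltW m0)// -[leRHS]invrK lef_pV2 ?posrE; lra.
have k1 : m / (1 - (q1 + q2)) * (delta + q1 * m) <= m * 2 * (eta' / 4).
  apply: ler_pM => //; first by rewrite divr_ge0 ?(ltW m0)//; lra.
    by rewrite addr_ge0 ?(ltW delta0)// mulr_ge0// ltW.
  by lra.
have : e0 * (B + eta') = m * (B + eta' / 2) by rewrite /e0 mulfVK// gt_eqF.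
have := ler_wpM2r (ltW Beta0) (ltW e0e); lra.
Unshelve. all: by end_near.
Qed.

End queue.

(** * Tails of the service laws *)

Lemma law_tail (R : realType) (F : probability R R) (x : R) :
  (F [set` `]x, +oo[] = 1 - law_cdf F x)%E.
Proof. by rewrite -setCitvl probability_setC. Qed.

(** The scale [theta] tends to 0, and once [theta <= delta] the tail is at most [theta / delta],
    because [alpha > 1]. *)
Lemma pareto_tail (R : realType) (mu : R) (FS : R -> probability R R)
    (delta eps : R) : 0 < mu -> 0 < delta -> 0 < eps ->
  (forall alpha, 1 < alpha -> pareto_law mu alpha (FS alpha)) ->
  \forall alpha \near 1^'+, (FS alpha [set` `]delta, +oo[] <= eps%:E)%E.
Proof.
move=> mu0 delta0 eps0 law.
pose k := Num.min delta (eps * delta).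
have k0 : 0 < k by rewrite lt_min delta0 mulr_gt0.
suff core (alpha : R) : 1 < alpha -> alpha <= 1 + k * mu ->
    (FS alpha [set` `]delta, +oo[] <= eps%:E)%E.
  near=> alpha; apply: core; near: alpha; first exact: nbhs_right_gt.
  by apply: nbhs_right_le; rewrite ltrDl mulr_gt0.
move=> alpha1 alphak; have alpha0 := lt_trans ltr01 alpha1.
rewrite law_tail law//; set theta := mu^-1 * _.
have theta0 : 0 < theta by rewrite mulr_gt0 ?invr_gt0// subr_gt0 invf_lt1.
have thetak : theta <= k.
  (* Yields [1 - alpha^-1 <= alpha - 1 <= k * mu]. *)
  have : 2 - alpha <= alpha^-1.
    rewrite -[leRHS]mul1r ler_pdivlMr//.
    by have := sqr_ge0 (alpha - 1); lra.
  by rewrite ler_pdivrMl//; lra.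
move: thetak; rewrite le_min => /andP[thd the].
rewrite thd -EFinB lee_fin opprB addrC subrK.
apply: (@le_trans _ _ (theta / delta)); last by rewrite ler_pdivrMr.
apply: ge1r_powR; last exact: ltW.
by rewrite divr_gt0//= ler_pdivrMr// mul1r.
Unshelve. all: by end_near.
Qed.

(** [Gamma] is the finite part of an integral, so lower bounds for it require finiteness. The
    integrand is at most [C] times the exponential density of rate 1/2, since [z * ln t - t / 2] is
    largest at [t = 2 * z]. *)
Lemma Gamma_integral_lty (R : realType) (z : R) : 0 < z ->
  (\int[lebesgue_measure]_(t in `]0%R, +oo[) (t `^ z * expR (- t))%:E < +oo)%E.
Proof.
move=> z0; pose C := 2 * expR (z * ln (z * 2) - z).
pose g (t : R) : \bar R := (C * exponential_pdf 2^-1 t)%:E.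
have C0 : 0 <= C by rewrite mulr_ge0// expR_ge0.
have g0 t : (0 <= g t)%E by rewrite lee_fin mulr_ge0// exponential_pdf_ge0.
apply: (@le_lt_trans _ _ (\int[lebesgue_measure]_t g t)%E); last first.
  rewrite /g; under eq_integral do rewrite EFinM.
  rewrite ge0_integralZl_EFin//; last 2 first.
  - by move=> t _; rewrite lee_fin exponential_pdf_ge0.
  - by apply/measurable_EFinP; exact: measurable_exponential_pdf.
  by rewrite integral_exponential_pdf// mule1 ltry.
rewrite integral_mkcond; apply: ge0_le_integral_nomeas => t _.
  by apply: erestrict_ge0 => x _; rewrite lee_fin mulr_ge0 ?powR_ge0 ?expR_ge0.
rewrite patchE; case: ifP => // /set_mem /=; rewrite in_itv/= andbT => t0.
rewrite /g lee_fin exponential_pdfE; last exact: ltW.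
rewrite /C.
rewrite [leRHS](_ : _ = expR (z * ln (z * 2) - z - 2^-1 * t)); last first.
  by rewrite mulNr [RHS]expRD; field.
rewrite /powR gt_eqF// -expRD ler_expR.
have : 1 + ln (t / (z * 2)) <= t / (z * 2).
  by rewrite -[leRHS]lnK ?posrE ?divr_gt0 ?mulr_gt0// expR_ge1Dx.
have z20 : 0 < z * 2 by rewrite mulr_gt0.
by rewrite ln_div// ler_pdivlMr//; lra.
Qed.

(** The integral over [[a, a + 1]] alone suffices. Since [a] is arbitrary, [Gamma (1 + z)] outgrows
    every geometric rate. *)
Lemma Gamma_ge (R : realType) (a z : R) : 0 < a -> 0 < z ->
  a `^ z * expR (- (a + 1)) <= Gamma (1 + z).
Proof.
move=> a0 z0; have := Gamma_integral_lty z0.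
rewrite /Gamma addrAC subrr add0r /Rintegral.
set G := (X in (X < _)%E) => Goo.
have G0 : (0 <= G)%E.
  by apply: integral_ge0 => t _; rewrite lee_fin mulr_ge0 ?powR_ge0 ?expR_ge0.
rewrite -lee_fin fineK ?ge0_fin_numE//.
set c := _ * _.
have c0 : 0 <= c by rewrite mulr_ge0 ?powR_ge0 ?expR_ge0.
have -> : c%:E = (\int[lebesgue_measure]_(t in `[a, (a + 1)%R]) c%:E)%E.
  rewrite integral_cst//=; set l := (X in (_ * X)%E).
  have -> : l = (if a < a + 1 then a + 1 - a else 0)%:E.
    apply: etrans (lebesgue_measure_itv _) _ => /=; rewrite lte_fin.
    by case: ifP.
  by rewrite ltrDl ltr01 addrAC subrr add0r mule1.
rewrite /G [leLHS]integral_mkcond [leRHS]integral_mkcond.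
apply: ge0_le_integral_nomeas => t _; first by apply: erestrict_ge0.
rewrite !patchE; case: ifP => [/set_mem /=|_]; last first.
  by case: ifP => // _; rewrite lee_fin mulr_ge0 ?powR_ge0 ?expR_ge0.
rewrite in_itv/= => /andP[at_ ta]; have t0 := lt_le_trans a0 at_.
rewrite mem_set/=; last by rewrite in_itv/= t0.
rewrite lee_fin; apply: ler_pM; rewrite ?powR_ge0 ?expR_ge0//.
  by apply: ge0_ler_powR => //; rewrite ?nnegrE; exact: ltW.
by rewrite ler_expR lerN2.
Qed.

(** By [Gamma_ge], [delta / beta] is at least [c * a ^ (1 / kappa)], whose power [kappa] is [a]
    times a factor tending to 1; a large [a] then makes the tail small. *)
Lemma weibull_tail (R : realType) (mu : R) (FS : R -> probability R R)
    (delta eps : R) : 0 < mu -> 0 < delta -> 0 < eps ->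
  (forall kappa, 0 < kappa -> weibull_law mu kappa (FS kappa)) ->
  \forall kappa \near 0^'+, (FS kappa [set` `]delta, +oo[] <= eps%:E)%E.
Proof.
move=> mu0 delta0 eps0 law.
(* Chosen so that [expR (- (a / 2)) <= eps]. *)
pose a := 1 + 2 * `|ln eps|.
have a0 : 0 < a by rewrite /a; have := normr_ge0 (ln eps); lra.
pose c := delta * mu * expR (- (a + 1)).
have c0 : 0 < c by rewrite !mulr_gt0// expR_gt0.
(* Below this threshold [kappa * |ln c| <= 1 / 2], so the power [kappa] of [c] is at least
   [1 + kappa * ln c >= 1 / 2]. *)
have k0 : 0 < (2 * (1 + `|ln c|))^-1.
  by rewrite invr_gt0 mulr_gt0//; have := normr_ge0 (ln c); lra.
suff core (kappa : R) : 0 < kappa -> kappa <= (2 * (1 + `|ln c|))^-1 ->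
    (FS kappa [set` `]delta, +oo[] <= eps%:E)%E.
  near=> kappa; apply: core; near: kappa; first exact: nbhs_right_gt.
  exact: nbhs_right_le.
move=> kappa0 kappac.
rewrite law_tail law// (ltW delta0) -EFinB lee_fin opprB addrC subrK.
set G := Gamma _; have Gge : a `^ kappa^-1 * expR (- (a + 1)) <= G.
  by apply: Gamma_ge; rewrite ?invr_gt0.
rewrite invrK.
have key : a / 2 <= (delta * (mu * G)) `^ kappa.
  apply: (@le_trans _ _ ((c * a `^ kappa^-1) `^ kappa)); last first.
    apply: ge0_ler_powR; rewrite ?nnegrE ?(ltW kappa0)//.
    - by rewrite mulr_ge0 ?(ltW c0) ?powR_ge0.
    - rewrite !mulr_ge0 ?ltW//; apply: lt_le_trans Gge.
      by rewrite mulr_gt0 ?powR_gt0 ?expR_gt0.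
    - rewrite /c -!mulrA ler_wpM2l ?(ltW delta0)// ler_wpM2l ?(ltW mu0)//.
      by rewrite mulrC.
  rewrite powRM ?(ltW c0) ?powR_ge0// -powRrM mulVf ?gt_eqF//.
  rewrite powRr1 ?(ltW a0)// mulrC ler_wpM2r ?(ltW a0)// /powR gt_eqF//.
  apply: le_trans (expR_ge1Dx _).
  have : kappa * `|ln c| <= 1 / 2.
    have n0 := normr_ge0 (ln c).
    move: kappac; rewrite -[(2 * _)^-1]mul1r ler_pdivlMr; last lra.
    by have := ltW kappa0; nra.
  rewrite -[X in X * _](gtr0_norm kappa0) -normrM ler_norml => /andP[]; lra.
apply: (@le_trans _ _ (expR (ln eps))); last by rewrite lnK.
rewrite ler_expR; have := ler_norm (- ln eps); rewrite normrN /a in key *.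
by lra.
Unshelve. all: by end_near.
Qed.

(** [S > delta] means that the standard normal variable exceeds [L / sigma + sigma / 2], a threshold
    that tends to infinity. *)
Lemma lognormal_tail (R : realType) (mu : R) (FS : R -> probability R R)
    (delta eps : R) : 0 < mu -> 0 < delta -> 0 < eps ->
  (forall sigma, 0 < sigma -> lognormal_law mu sigma (FS sigma)) ->
  \forall sigma \near +oo, (FS sigma [set` `]delta, +oo[] <= eps%:E)%E.
Proof.
move=> mu0 delta0 eps0 law.
have [K K0 NK] : exists2 K : R, 0 < K &
    (normal_prob 0 1 [set` `]K, +oo[] <= eps%:E)%E.
  have mid : measurable_fun setT (idfun : measurableTypeR R -> R).
    exact: measurable_id.
  pose N : {RV (normal_prob (0 : R) 1) >-> R} :=
    HB.pack (idfun : measurableTypeR R -> R)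
      (isMeasurableFun.Build _ _ _ _ _ mid).
  have /fine_cvgP[finN /cvgrPdist_le /(_ _ eps0) tail] := cvg_ccdfy0 N.
  near (+oo : set_system R) => K; exists K.
    by near: K; exact: nbhs_pinfty_gt.
  have finK : ccdf N K \is a fin_num by near: K.
  have leK : `|0 - fine (ccdf N K)| <= eps by near: K.
  suff : (ccdf N K <= eps%:E)%E by [].
  rewrite -(fineK finK) lee_fin; apply: le_trans (ler_norm _) _.
  by rewrite -normrN -sub0r.
pose L := ln delta + ln mu.
(* These bounds give [K * sigma <= sigma ^+ 2 / 2 - |L| * sigma <= sigma ^+ 2 / 2 + L]. *)
suff core (sigma : R) : 1 <= sigma -> 2 * (K + `|L|) <= sigma ->
    (FS sigma [set` `]delta, +oo[] <= eps%:E)%E.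
  near=> sigma; apply: core; near: sigma; apply: nbhs_pinfty_ge;
    exact: num_real.
move=> sigma1 sigmaK; have sigma0 := lt_le_trans ltr01 sigma1.
rewrite law//; apply: le_trans NK.
rewrite /normal_prob [leLHS]integral_mkcond [leRHS]integral_mkcond.
apply: ge0_le_integral_nomeas => n _.
  by apply: erestrict_ge0 => x _; rewrite lee_fin normal_pdf_ge0.
rewrite !patchE; case: ifP => [/set_mem /=|_]; last first.
  by case: ifP => // _; rewrite lee_fin normal_pdf_ge0.
suff nK : delta < expR (- ln mu - sigma ^+ 2 / 2 + sigma * n) -> K < n.
  by rewrite in_itv/= andbT => /nK Kn; rewrite mem_set//= in_itv/= Kn.
rewrite -[X in X < _]lnK ?posrE// ltr_expR => nd.
have L0 := ler_norm (- L); rewrite normrN in L0.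
have : K * sigma < n * sigma.
  suff : K * sigma <= L + sigma ^+ 2 / 2 by rewrite /L in L0 *; lra.
  have := normr_ge0 L; nra.
by rewrite ltr_pM2r.
Unshelve. all: by end_near.
Qed.

Theorem theorem3 (R : realType) (lambda mu a0 : R) (FX : probability R R)
    (lambda_gt0 : 0 < lambda) (lambda_lt_mu : lambda < mu) (a0_ge0 : 0 <= a0)
    (mean_FX : law_mean FX = (lambda^-1)%:E) :
  [/\ (forall (FS : probability R R) (Q : gg1_queue FX FS),
        law_mean FS = (mu^-1)%:E ->
        continuous (law_cdf FX) \/ continuous (law_cdf FS) ->
        (age_bound FX <= average_age a0 Q)%E),
      (forall (FS : R -> probability R R)
          (Q : forall alpha : R, gg1_queue FX (FS alpha)),
        (forall alpha : R, 1 < alpha -> pareto_law mu alpha (FS alpha)) ->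
        average_age a0 (Q alpha) @[alpha --> 1^'+] --> age_bound FX),
      (forall (FS : R -> probability R R)
          (Q : forall sigma : R, gg1_queue FX (FS sigma)),
        (forall sigma : R, 0 < sigma -> lognormal_law mu sigma (FS sigma)) ->
        average_age a0 (Q sigma) @[sigma --> +oo] --> age_bound FX) &
      (forall (FS : R -> probability R R)
          (Q : forall kappa : R, gg1_queue FX (FS kappa)),
        (forall kappa : R, 0 < kappa -> weibull_law mu kappa (FS kappa)) ->
        average_age a0 (Q kappa) @[kappa --> 0^'+] --> age_bound FX)].
Proof.
have mu_gt0 : 0 < mu := lt_trans lambda_gt0 lambda_lt_mu.
split.
- move=> FS Q _ _.
  exact: (age_bound_le_average_age lambda_gt0 a0_ge0 mean_FX).
- move=> FS Q law.
  apply: (average_age_cvg lambda_gt0 a0_ge0 mean_FX) => delta eps d0 e0.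
  exact: pareto_tail law.
- move=> FS Q law.
  apply: (average_age_cvg lambda_gt0 a0_ge0 mean_FX) => delta eps d0 e0.
  exact: lognormal_tail law.
- move=> FS Q law.
  apply: (average_age_cvg lambda_gt0 a0_ge0 mean_FX) => delta eps d0 e0.
  exact: weibull_tail law.
Qed.
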